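(* Let $X$ be a complex Banach space. The following are equivalent: (a) the Cluster Value Theorem holds for $H_b(X)$; (b) the Cluster Value Theorem holds for $H_b(U)$ for every nonempty balanced open set $U\subset X$; (c) the Cluster Value Theorem holds for $H_b(U)$ for some nonempty balanced open set $U\subset X$.
   Context: A set $U\subset X$ is balanced if $\lambda U\subset U$ for all $\lambda\in\mathbb C$ with $|\lambda|\le 1$. For an open set $U\subset X$, a $U$-bounded set is a bounded set $A\subset U$ whose distance to the boundary of $U$ is positive (if $U=X$, any bounded set). $H_b(U)$ is the Fréchet algebra of holomorphic functions $f:U\to\mathbb C$ bounded on $U$-bounded sets, with the topology of uniform convergence on $U$-bounded sets. $\mathcal M(H_b(U))$ is the set of continuous nonzero complex-valued algebra homomorphisms on $H_b(U)$, the map $\pi:\mathcal M(H_b(U))\to X^{**}$ is $\pi(\varphi)=\varphi|_{X^*}$, and $\hat f(\varphi)=\varphi(f)$. For $A\subset U$, $\varphi\prec A$ means $|\varphi(f)|\le\sup_{x\in A}|f(x)|$ for every $f\in H_b(U)$. For $z\in X^{**}$, $\mathcal M_{z,A}=\{\varphi\in\mathcal M(H_b(U)):\pi(\varphi)=z,\ \varphi\prec A\}$. $Cl_A(f,z)$ is the set of all $\lambda\in\mathbb C$ for which there is a net $(x_\alpha)\subset A$ with $x_\alpha\to z$ in $\sigma(X^{**},X^* )$ and $f(x_\alpha)\to\lambda$. The Cluster Value Theorem is said to hold for $H_b(U)$ if $Cl_A(f,z)=\hat f(\mathcal M_{z,A})$ for every $f\in H_b(U)$, every $z\in X^{**}$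 and every $U$-bounded set $A$. *)

(* Defs.v *)
From HB Require Import structures.
From mathcomp Require Import all_boot all_order all_algebra.
From mathcomp Require Import complex.
From mathcomp Require Import all_classical all_reals all_analysis.

Set Implicit Arguments.
Unset Strict Implicit.
Unset Printing Implicit Defensive.

Import Order.TTheory GRing.Theory Num.Theory.
Import numFieldNormedType.Exports.

Local Open Scope classical_set_scope.
Local Open Scope ring_scope.
Local Open Scope complex_scope.

(* The complex numbers with their topology: the alias [^o] is what carries the
   normed module structure of [R[i]] over itself. *)
Notation Cplx R := (R[i]^o).

(* Over [R[i]] norms take their values in [R[i]]; these values are nonnegative
   reals, so that the real part loses nothing. *)
Definition rnorm (R : realType) (V : normedModType R[i]) (v : V) : R :=
  complex.Re `|v|.

Section rnorm_theory.
Context {R : realType} {V : normedModType R[i]}.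
Implicit Types u v : V.

Lemma rnormE v : (rnorm v)%:C = `|v|.
Proof. by rewrite /rnorm RRe_real// normr_real. Qed.

Lemma rnorm_le v (r : R) : (rnorm v <= r) = (`|v| <= r%:C).
Proof. by rewrite -rnormE lecR. Qed.

Lemma rnorm_ge0 v : 0 <= rnorm v.
Proof. by rewrite -lecR rnormE normr_ge0. Qed.

Lemma rnormD u v : rnorm (u + v) <= rnorm u + rnorm v.
Proof. by rewrite -lecR rmorphD /= !rnormE ler_normD. Qed.

Lemma rnormZ (a : Cplx R) v : rnorm (a *: v) = rnorm a * rnorm v.
Proof. by apply: complexI; rewrite rmorphM /= !rnormE normrZ. Qed.

Lemma rnorm_eq0 v : rnorm v = 0 -> v = 0.
Proof. by move=> v0; apply: normr0_eq0; rewrite -rnormE v0. Qed.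

End rnorm_theory.

Section dual_space.
Context {R : realType}.
Variable X : normedModType R[i].

Definition dual_pred : {pred X -> Cplx R} :=
  [pred l : X -> Cplx R | `[< linear l /\ continuous l >]].

Record dual := Dual {
  dual_fun :> X -> Cplx R;
  dual_funP : dual_fun \in dual_pred }.

HB.instance Definition _ := [isSub for dual_fun].
HB.instance Definition _ := [Choice of dual by <:].

Fact dual_submod_closed : submod_closed dual_pred.
Proof.
split=> [|a l m].
- by apply/asboolP; split=> [a x y|x]; [rewrite /= scaler0 addr0|exact: cvg_cst].
- move=> /asboolP[ll lc] /asboolP[ml mc]; apply/asboolP; split=> [b x y|x].
  + rewrite !fctE ll ml !scalerDr !addrA; congr (_ + _).
    rewrite -!addrA; congr (_ + _); last by rewrite addrC.
    by rewrite !scalerA mulrC.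
  + by apply: cvgD; [apply: cvgZr; exact: lc|exact: mc].
Qed.

HB.instance Definition _ :=
  GRing.isSubmodClosed.Build R[i] (X -> Cplx R) dual_pred dual_submod_closed.
HB.instance Definition _ := [SubChoice_isSubLmodule of dual by <:].

Implicit Types l m : dual.

Definition dual_norm l : R :=
  sup [set rnorm (l x) | x in [set x : X | `|x| <= 1]].

Lemma dual_linear l : linear l.
Proof. by have /asboolP[] := dual_funP l. Qed.

Lemma dual_continuous l : continuous l.
Proof. by have /asboolP[] := dual_funP l. Qed.

HB.instance Definition _ l :=
  GRing.isLinear.Build R[i] X (Cplx R) *:%R (dual_fun l) (dual_linear l).

Lemma dual_norm_has_sup l :
  has_sup [set rnorm (l x) | x in [set x : X | `|x| <= 1]].
Proof.
split; first by exists (rnorm (l 0)), 0 => //=; rewrite normr0.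
have /linear_bounded_continuous/linear_boundedP := @dual_continuous l.
move=> /pinfty_ex_gt0[M M0 lM]; exists (complex.Re M) => _ [x /= x1 <-].
rewrite rnorm_le RRe_real ?gtr0_real//.
by rewrite (le_trans (lM x))// ler_piMr// ltW.
Qed.

Lemma dual_norm_ub l x : `|x| <= 1 -> rnorm (l x) <= dual_norm l.
Proof.
by move=> x1; apply: sup_upper_bound; [exact: dual_norm_has_sup|exists x].
Qed.

Lemma dual_norm_lub l (r : R) :
  (forall x, `|x| <= 1 -> rnorm (l x) <= r) -> dual_norm l <= r.
Proof.
move=> lr; apply: ge_sup; first by have [] := dual_norm_has_sup l.
by move=> _ [x /= x1 <-]; exact: lr.
Qed.

Fact dual_normD l m : (dual_norm (l + m))%:C <= (dual_norm l)%:C + (dual_norm m)%:C.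
Proof.
rewrite -rmorphD lecR; apply: dual_norm_lub => x x1.
by rewrite (le_trans (rnormD _ _))// lerD// dual_norm_ub.
Qed.

Fact dual_normZ_le (a : R[i]) l :
  (dual_norm (a *: l))%:C <= `|a| * (dual_norm l)%:C.
Proof.
rewrite -(rnormE (a : Cplx R)) -rmorphM lecR.
apply: dual_norm_lub => x x1.
by rewrite rnormZ ler_wpM2l ?rnorm_ge0// dual_norm_ub.
Qed.

Fact dual_normZ (a : R[i]) l : (dual_norm (a *: l))%:C = `|a| * (dual_norm l)%:C.
Proof.
have [->|a0] := eqVneq a 0.
  apply/eqP; rewrite eq_le dual_normZ_le normr0 mul0r lecR.
  by rewrite (le_trans (rnorm_ge0 ((0 *: l) 0)))// dual_norm_ub// normr0.
apply/eqP; rewrite eq_le dual_normZ_le /= -ler_pdivlMl ?normr_gt0//.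
have := dual_normZ_le a^-1 (a *: l).
by rewrite scalerA mulVf// scale1r normfV.
Qed.

Fact dual_norm_eq0 l : (dual_norm l)%:C = 0 -> l = 0.
Proof.
move=> [l0]; apply/val_inj/funext => x /=.
have [->|x0] := eqVneq x 0; first by rewrite linear0.
have : `| `|x|^-1 *: x | <= 1.
  by rewrite normrZ normfV normr_id mulVf// normr_eq0.
move=> /(@dual_norm_ub l); rewrite l0 => lx_le0.
have /rnorm_eq0/eqP : rnorm (l (`|x|^-1 *: x)) = 0.
  by apply/eqP; rewrite eq_le lx_le0 rnorm_ge0.
by rewrite linearZ scaler_eq0 invr_eq0 normr_eq0 (negbTE x0) => /eqP.
Qed.

HB.instance Definition _ := @Lmodule_isNormed.Build R[i] dual
  (fun l => (dual_norm l)%:C) dual_normD dual_normZ dual_norm_eq0.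

End dual_space.

Definition bidual (R : realType) (X : normedModType R[i]) := dual (dual X).

Section bounded_type.
Context {R : realType} {X : normedModType R[i]}.
Implicit Types (U A B : set X) (f : X -> Cplx R) (z : bidual X).

Definition balanced U := forall a : R[i], `|a| <= 1 ->
  [set a *: x | x in U] `<=` U.

Definition boundary U : set X := closure U `\` interior U.

(* An infimum in the extended reals: the distance to the empty set is [+oo]. *)
Definition set_dist A B : \bar R :=
  ereal_inf [set (rnorm (p.1 - p.2))%:E | p in A `*` B].

(* When [U] is the whole space its boundary is empty, and the last condition
   holds for every [A]. *)
Definition Ubounded U : set (set X) :=
  [set A | [/\ bounded_set A, A `<=` U & (0 < set_dist A (boundary U))%E]].

(* Differentiability is over the scalars [R[i]], hence complex. *)
Definition holomorphic_on U f := forall x, U x -> differentiable f x.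

(* A function on [U] is represented by a function on [X] whose values outside
   of [U] are irrelevant. *)
Definition Hb U : set (X -> Cplx R) :=
  [set f | holomorphic_on U f /\
           forall A, Ubounded U A -> [bounded f x | x in A]].

(* The functions on [X] with the topology of uniform convergence on the
   [U]-bounded sets; [Hb U] carries the subspace topology. *)
Definition Hb_space U := {family Ubounded U, X -> Cplx R}.

Implicit Types phi : (X -> Cplx R) -> Cplx R.

(* [phi] matters on [Hb U] only.  The first condition makes it a function on
   [Hb U] with functions that agree on [U] identified. *)
Record character U phi : Prop := {
  character_eq : forall f g, Hb U f -> Hb U g ->
    (forall x, U x -> f x = g x) -> phi f = phi g;
  character_add : forall f g, Hb U f -> Hb U g -> phi (f + g) = phi f + phi g;
  character_scale : forall (a : R[i]) f, Hb U f -> phi (a *: f) = a *: phi f;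
  character_mul : forall f g, Hb U f -> Hb U g ->
    phi (fun x => f x * g x) = phi f * phi g;
  character_neq0 : exists2 f, Hb U f & phi f != 0;
  character_continuous :
    {within (Hb U : set (Hb_space U)), continuous (phi : Hb_space U -> Cplx R)}
}.

Definition spectrum U : set ((X -> Cplx R) -> Cplx R) := [set phi | character U phi].

Definition spectrum_proj phi : dual X -> Cplx R := fun l => phi (l : X -> Cplx R).

Definition gelfand f phi : Cplx R := phi f.

Definition prec U phi A := forall f, Hb U f ->
  ((rnorm (phi f))%:E <= ereal_sup [set (rnorm (f x))%:E | x in A])%E.

Definition fiber U z A : set ((X -> Cplx R) -> Cplx R) :=
  [set phi | [/\ spectrum U phi, spectrum_proj phi = z :> (dual X -> Cplx R) &
                 prec U phi A]].

Definition directed (I : Type) (le : I -> I -> Prop) := [/\ inhabited I,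
  forall i, le i i,
  forall i j k, le i j -> le j k -> le i k &
  forall i j, exists k, le i k /\ le j k].

(* Convergence of a net is convergence along the filter of tails of its index
   set. *)
Definition tails (I : Type) (le : I -> I -> Prop) : set_system I :=
  [set S | exists i, forall j, le i j -> S j].

(* [X] sits in its bidual by evaluation, and [sigma(X**, X* )] is the topology
   of pointwise convergence on the dual. *)
Definition cluster_set A f z : set (Cplx R) :=
  [set c | exists (I : Type) (le : I -> I -> Prop) (x : I -> X),
    [/\ directed le, (forall i, A (x i)),
        (fun i => (fun l => l (x i)) : {ptws dual X -> Cplx R}) @ tails le -->
          ((z : dual X -> Cplx R) : {ptws dual X -> Cplx R}) &
        f \o x @ tails le --> c]].

Definition cluster_value_theorem U := forall f, Hb U f ->
  forall z A, Ubounded U A ->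
  cluster_set A f z = [set gelfand f phi | phi in fiber U z A].

End bounded_type.

Arguments cluster_value_theorem {R X} U.

(* Main.v *)
From HB Require Import structures.
Require Import Defs.
From mathcomp Require Import all_boot all_order all_algebra.
From mathcomp Require Import complex.
From mathcomp Require Import ring lra.
From mathcomp Require Import all_classical all_reals all_analysis.
Import numFieldNormedType.Exports.
Import Order.TTheory GRing.Theory Num.Theory.
Local Open Scope classical_set_scope.
Local Open Scope ring_scope.
Local Open Scope complex_scope.

Set Implicit Arguments.
Unset Strict Implicit.
Unset Printing Implicit Defensive.

(** Every cluster value comes from a character: a net in [A] converging weak-star
    to [z] generates a filter on the space, and evaluation along a finer
    ultrafilter is a character in the fiber ([cluster_sub_fiber]).  Hence the
    theorem is about the converse, [phi f] being a cluster value for every [phi]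
    in the fiber, and this converse is passed between [X] and a balanced [U] by
    approximation: the entire functions of bounded type are uniformly dense in
    [Hb U] on every [U]-bounded set ([entire_dense]).

    From [X] to [U]: a character over [U] dominated by [A] restricts to one over
    [X], and cluster values survive uniform approximation of [f] on [A]
    ([cluster_value_balanced]).  From [U] to [X]: a dilation shrinks the bounded
    set [A] into a ball contained in [U]; a character over [X] dominated by [A]
    then becomes one over [U] dominated by the small copy of [A], because its
    value on a member of [Hb U] can be defined as a limit over entire
    approximants; dilating back turns cluster values over [U] into cluster values
    over [X] ([cluster_value_whole]).

    The approximants are Fejer means of the Taylor series at the origin, whose
    term of degree [j] at [x] is the mean of [f (l *: x) * l ^- j] over the unit
    circle.  They converge uniformly on a [U]-bounded set because the Fejer
    kernel is positive, has mean one and satisfies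
    [|l - 1|^2 * F_J l <= 4 / J], while [f] is Lipschitz along the rotations of
    that set ([fejer_approx], [ball_lipschitz]).

    The one-variable theory needed for this starts from complex differentiability
    at each point and from means over the [2^n]-th roots of unity, [n] going to
    infinity along a fixed ultrafilter.  The Goursat bisection argument is applied
    directly to Riemann sums: the boundary sum of level [n.+1] of a rectangle is
    exactly the sum of the boundary sums of level [n] of its four quarters, and it
    vanishes exactly on affine functions ([goursat]).  Through the exponential
    this says that circle means of a function holomorphic on an annulus are the
    same on all its circles ([lim_mean_radius]).  So the coefficients scale like
    powers of the radius, those of negative degree vanish, and Fejer summation
    gives a second-order Taylor estimate depending on a bound of the function only
    ([taylor_bound]).  That estimate makes a bounded pointwise limit of
    holomorphic functions holomorphic ([ball_bnd_limit]), which is why the Taylor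
    terms are entire ([taylor_term_Hb]). *)

(** * The modulus, and limits along ultrafilters *)

Section modulus.
Context {R : realType}.
Implicit Types (V : normedModType R[i]) (a b : Cplx R).

Lemma rnorm0 V : rnorm (0 : V) = 0.
Proof. by rewrite /rnorm normr0. Qed.

Lemma rnormN V (v : V) : rnorm (- v) = rnorm v.
Proof. by rewrite /rnorm normrN. Qed.

Lemma rnorm_distC V (u v : V) : rnorm (u - v) = rnorm (v - u).
Proof. by rewrite -rnormN opprB. Qed.

Lemma rnorm_gt0 V (v : V) : (0 < rnorm v) = (v != 0).
Proof.
rewrite lt0r rnorm_ge0 andbT; congr (~~ _).
by apply/eqP/eqP => [/rnorm_eq0//|->]; rewrite rnorm0.
Qed.

Lemma rnormM a b : rnorm (a * b : Cplx R) = rnorm a * rnorm b.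
Proof. exact: rnormZ. Qed.

Lemma rnorm_real (r : R) : rnorm (r%:C : Cplx R) = `|r|.
Proof. by rewrite /rnorm normc_def /= expr0n /= addr0 sqrtr_sqr. Qed.

Lemma rnorm1 : rnorm (1 : Cplx R) = 1.
Proof. by rewrite /rnorm normr1. Qed.

Lemma rnormi : rnorm ('i%C : Cplx R) = 1.
Proof. by rewrite /rnorm normc_def /= expr0n /= add0r expr1n sqrtr1. Qed.

Lemma rnormX a n : rnorm (a ^+ n : Cplx R) = rnorm a ^+ n.
Proof. by elim: n => [|n IH]; rewrite ?expr0 ?rnorm1// !exprS rnormM IH. Qed.

Lemma rnormV a : rnorm (a^-1 : Cplx R) = (rnorm a)^-1.
Proof.
have [->|a0] := eqVneq a 0; first by rewrite invr0 rnorm0 invr0.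
have r0 : rnorm a != 0 by rewrite gt_eqF// rnorm_gt0.
by apply: (mulfI r0); rewrite -rnormM divff// divff// rnorm1.
Qed.

Lemma rnorm_sum V I (r : seq I) (P : pred I) (F : I -> V) :
  rnorm (\sum_(i <- r | P i) F i) <= \sum_(i <- r | P i) rnorm (F i).
Proof.
elim/big_ind2 : _ => [|x1 x2 y1 y2 h1 h2|//]; first by rewrite rnorm0.
by rewrite (le_trans (rnormD _ _))// lerD.
Qed.

Lemma rnorm_triangle V (w u v : V) : rnorm (u - v) <= rnorm (u - w) + rnorm (w - v).
Proof. by apply: le_trans (rnormD _ _); rewrite addrA subrK. Qed.

Lemma rnorm_Re a : `|complex.Re a| <= rnorm a.
Proof.
rewrite /rnorm normc_def /= -(sqrtr_sqr (complex.Re a)) ler_wsqrtr// lerDl sqr_ge0//.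
Qed.

Lemma rnorm_Im a : `|complex.Im a| <= rnorm a.
Proof.
rewrite /rnorm normc_def /= -(sqrtr_sqr (complex.Im a)) ler_wsqrtr// lerDr sqr_ge0//.
Qed.

Lemma rnorm_complex (x y : R) : rnorm (x +i* y : Cplx R) <= `|x| + `|y|.
Proof.
have -> : (x +i* y : Cplx R) = x%:C + 'i%C * y%:C :> Cplx R.
  by rewrite [LHS]complexE.
by rewrite (le_trans (rnormD _ _))// rnormM rnormi mul1r !rnorm_real.
Qed.

Lemma rnorm_le_eps V (v : V) : (forall e : R, 0 < e -> rnorm v <= e) -> v = 0.
Proof.
move=> h; apply: rnorm_eq0; apply/eqP; rewrite eq_le rnorm_ge0 andbT.
by apply/ler_addgt0Pl => e e0; rewrite addr0; exact: h.
Qed.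

Lemma nbhs_rnorm V (x : V) (S : set V) :
  nbhs x S <-> exists2 e : R, 0 < e & forall y, rnorm (y - x) <= e -> S y.
Proof.
split.
- move=> /nbhs_normP[/= e e0 h].
  have e1 : e = (complex.Re e)%:C by rewrite RRe_real// gtr0_real.
  exists (complex.Re e / 2) => [|y yx].
    by rewrite divr_gt0// -ltcR -e1.
  apply: h => /=; rewrite -rnormE rnorm_distC e1 ltcR (le_lt_trans yx)//.
  by rewrite ltr_pdivrMr// ltr_pMr ?ltr1n// -ltcR -e1.
- move=> [e e0 h]; apply/nbhs_normP; exists e%:C; first by rewrite /= ltcR.
  by move=> y /=; rewrite -rnormE ltcR rnorm_distC => /ltW/h.
Qed.

Lemma cvg_rnorm V T (F : set_system T) (FF : Filter F) (u : T -> V) (c : V) :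
  u @ F --> c <-> forall e : R, 0 < e -> F [set t | rnorm (u t - c) <= e].
Proof.
split=> [h e e0|h S /nbhs_rnorm[e e0 hS]].
  have /h// : nbhs c [set y | rnorm (y - c) <= e] by apply/nbhs_rnorm; exists e.
by rewrite /nbhs/=; apply: (@filterS _ F _ _ _ _ (h e e0)) => t; exact: hS.
Qed.

Lemma cvg_unique_rnorm V T (F : set_system T) (FF : ProperFilter F) (u : T -> V) (c d : V) :
  u @ F --> c -> u @ F --> d -> c = d.
Proof.
move=> /cvg_rnorm uc /cvg_rnorm ud; apply/eqP; rewrite -subr_eq0; apply/eqP.
apply: rnorm_le_eps => e e0.
have e2 : 0 < e / 2 by rewrite divr_gt0.
have [t [h1 h2]] := filter_ex (filterI (uc _ e2) (ud _ e2)).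
rewrite (le_trans (rnorm_triangle (u t) _ _))// (splitr e) lerD// rnorm_distC//.
Qed.

Lemma cvg_rnorm_le V T (F : set_system T) (FF : ProperFilter F) (u : T -> V) (c : V) (r : R) :
  u @ F --> c -> F [set t | rnorm (u t) <= r] -> rnorm c <= r.
Proof.
move=> /cvg_rnorm uc ur; apply/ler_addgt0Pl => e e0.
have [t [h1 h2]] := filter_ex (filterI (uc _ e0) ur).
have -> : c = (c - u t) + u t by rewrite subrK.
by rewrite (le_trans (rnormD _ _))// lerD// rnorm_distC.
Qed.

Lemma ultra_fmap T U (f : T -> U) (F : set_system T) :
  UltraFilter F -> UltraFilter (f @ F).
Proof.
move=> FU; split=> [|G GF sG]; first exact: fmap_proper_filter.
rewrite predeqE => A; split=> [GA|]; last exact: sG.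
have [//|nA] := in_ultra_setVsetC (f @^-1` A) FU.
have GnA : G (~` A) by exact: sG.
by have [x []] := filter_ex (filterI GA GnA).
Qed.

Lemma ultra_real_cvg T (F : set_system T) (FU : UltraFilter F) (u : T -> R) (M : R) :
  (F [set t | `|u t| <= M]) -> exists c : R, u @ F --> c.
Proof.
move=> uM.
have := @segment_compact R (- M) M; rewrite compact_ultra => /(_ (u @ F) (ultra_fmap u FU)).
case.
- by rewrite /nbhs /=; apply: filterS uM => t /=; rewrite in_itv /= -ler_norml.
- by move=> c [_ h]; exists c.
Qed.

(** Bounded complex families converge along every ultrafilter, since real segments
    are compact. *)
Lemma ultra_cvg T (F : set_system T) (FU : UltraFilter F) (u : T -> Cplx R) (M : R) :
  F [set t | rnorm (u t) <= M] -> exists c : Cplx R, u @ F --> c.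
Proof.
move=> uM.
have [a ha] : exists c : R, (fun t => complex.Re (u t)) @ F --> c.
  apply: (@ultra_real_cvg _ _ _ _ M); apply: filterS uM => t /=.
  exact/le_trans/rnorm_Re.
have [b hb] : exists c : R, (fun t => complex.Im (u t)) @ F --> c.
  apply: (@ultra_real_cvg _ _ _ _ M); apply: filterS uM => t /=.
  exact/le_trans/rnorm_Im.
exists (a +i* b); apply/cvg_rnorm => e e0.
have e2 : 0 < e / 2 by rewrite divr_gt0.
move/cvgrPdist_le : ha => /(_ _ e2) ha; move/cvgrPdist_le : hb => /(_ _ e2) hb.
near=> t => /=.
have -> : u t - (a +i* b : Cplx R) = ((complex.Re (u t) - a) +i* (complex.Im (u t) - b) : Cplx R).
  by case: (u t).
rewrite (le_trans (rnorm_complex _ _))// (splitr e) lerD// distrC; near: t => //.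
Unshelve. all: end_near. Qed.

End modulus.

(** * Goursat lemma for left Riemann sums *)

Section goursat.
Context {R : realType}.
Local Notation C := (Cplx R).
Implicit Types (u v : R -> C) (h : R -> R -> C) (a c l m x y : R) (n : nat).

(** Dyadic subdivisions, because of [left_sumS]. *)
Definition left_sum n u a l : C :=
  (l / 2 ^+ n)%:C * \sum_(k < 2 ^ n) u (a + l * k%:R / 2 ^+ n).

(** Halving the interval and coarsening the subdivision by one level keeps the
    same sample points; this exactness is what replaces the additivity of the
    integral. *)
Lemma left_sumS n u a l :
  left_sum n.+1 u a l = left_sum n u a (l / 2) + left_sum n u (a + l / 2) (l / 2).
Proof.
have n2 : 2 ^+ n != 0 :> R by rewrite expf_neq0.
have n20 : 2 != 0 :> R by [].
rewrite /left_sum -mulrDr exprS.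
congr (_%:C * _); first by field; rewrite n2.
rewrite expnS mul2n -addnn big_split_ord /=; congr (_ + _).
  by apply: eq_bigr => i _; congr u; field; rewrite n2.
apply: eq_bigr => i _; congr u; rewrite natrD natrX.
by field; rewrite n2.
Qed.

Lemma left_sumD n u v a l :
  left_sum n (fun t => u t + v t) a l = left_sum n u a l + left_sum n v a l.
Proof. by rewrite /left_sum big_split mulrDr. Qed.

Lemma left_sumN n u a l : left_sum n (fun t => - u t) a l = - left_sum n u a l.
Proof. by rewrite /left_sum sumrN mulrN. Qed.

Lemma left_sum_cst n (w : C) a l : left_sum n (fun=> w) a l = l%:C * w.
Proof.
rewrite /left_sum sumr_const card_ord -(mulr_natr w).
have -> : (2 ^ n)%:R = (2 ^+ n : R)%:C :> C by rewrite -natrX rmorph_nat.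
rewrite (mulrC w) mulrA -rmorphM /= divfK// expf_neq0//.
Qed.

Lemma left_sum_le n u a l (M : R) : 0 <= l ->
  (forall t, a <= t <= a + l -> rnorm (u t) <= M) -> rnorm (left_sum n u a l) <= l * M.
Proof.
move=> l0 uM.
rewrite rnormM rnorm_real ger0_norm ?divr_ge0 ?exprn_ge0//.
have n2 : 0 < 2 ^+ n :> R by rewrite exprn_gt0.
apply: (@le_trans _ _ (l / 2 ^+ n * \sum_(k < 2 ^ n) M)).
  rewrite ler_wpM2l ?divr_ge0 ?exprn_ge0//.
  rewrite (le_trans (rnorm_sum _ _ _))// ler_sum// => k _; apply: uM.
  have k1 : k%:R <= 2 ^+ n :> R by rewrite -natrX ler_nat ltnW.
  rewrite lerDl lerD2l ler_pdivrMr// ler_wpM2l// andbT.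
  by rewrite divr_ge0// 1?mulr_ge0// ltW.
rewrite sumr_const card_ord -(mulr_natr M) natrX.
by rewrite mulrCA divfK ?gt_eqF// mulrC.
Qed.

(** The Riemann sum for the integral of [h (x + iy)] along the boundary, taken
    counterclockwise, of the rectangle with lower left corner [(a, c)], width [l]
    and height [m]. *)
Definition boundary_sum n h a c l m : C :=
  (left_sum n (fun x => h x c) a l - left_sum n (fun x => h x (c + m)) a l)
  + 'i%C * (left_sum n (fun y => h (a + l) y) c m - left_sum n (fun y => h a y) c m).

(** The sums along the inner sides of the four quarters cancel in pairs. *)
Lemma boundary_sumS n h a c l m : boundary_sum n.+1 h a c l m =
  boundary_sum n h a c (l / 2) (m / 2) + boundary_sum n h (a + l / 2) c (l / 2) (m / 2)
  + boundary_sum n h a (c + m / 2) (l / 2) (m / 2)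
  + boundary_sum n h (a + l / 2) (c + m / 2) (l / 2) (m / 2).
Proof.
have e z w : z + w / 2 + w / 2 = z + w :> R by field.
rewrite /boundary_sum !left_sumS !e; ring.
Qed.

Lemma boundary_sumD n h h' a c l m : boundary_sum n (fun x y => h x y + h' x y) a c l m =
  boundary_sum n h a c l m + boundary_sum n h' a c l m.
Proof. by rewrite /boundary_sum !left_sumD; ring. Qed.

(** For an affine function the difference of two opposite sides is a constant,
    and left sums of constants are exact; so there is no discretization error. *)
Lemma boundary_sum_affine n (w d : C) a c l m x0 y0 :
  boundary_sum n (fun x y => w + d * ((x - x0) +i* (y - y0) : C)) a c l m = 0.
Proof.
rewrite /boundary_sum -!left_sumN -!left_sumD.
have -> : (fun t => w + d * ((t - x0) +i* (c - y0) : C)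
     + - (w + d * ((t - x0) +i* (c + m - y0) : C))) = fun=> - (d * 'i%C * m%:C) :> C.
  apply/funext => t; rewrite opprD addrACA subrr add0r -mulrBr -mulrA -mulrN; congr (_ * _).
  by apply/eqP; rewrite eq_complex /=; apply/andP; split; apply/eqP; ring.
have -> : (fun t => w + d * ((a + l - x0) +i* (t - y0) : C)
     + - (w + d * ((a - x0) +i* (t - y0) : C))) = fun=> d * l%:C :> C.
  apply/funext => t; rewrite opprD addrACA subrr add0r -mulrBr; congr (_ * _).
  by apply/eqP; rewrite eq_complex /=; apply/andP; split; apply/eqP; ring.
by rewrite !left_sum_cst; ring.
Qed.

Lemma boundary_sum_le n h a c l m (M : R) : 0 <= l -> 0 <= m ->
  (forall x y, a <= x <= a + l -> c <= y <= c + m -> rnorm (h x y) <= M) ->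
  rnorm (boundary_sum n h a c l m) <= 2 * (l + m) * M.
Proof.
move=> l0 m0 hM.
have [cc cm] : c <= c <= c + m /\ c <= c + m <= c + m by rewrite !lexx lerDl m0.
have [aa al] : a <= a <= a + l /\ a <= a + l <= a + l by rewrite !lexx lerDl l0.
rewrite (le_trans (rnormD _ _))// rnormM rnormi mul1r.
have -> : 2 * (l + m) * M = (l * M + l * M) + (m * M + m * M) by ring.
by rewrite lerD// (le_trans (rnormD _ _))// rnormN lerD// left_sum_le// => t ht; apply: hM.
Qed.

Lemma nested_intervals (p : nat -> R) l : 0 < l ->
  (forall i, p i <= p i.+1 <= p i + l / 2 ^+ i.+1) ->
  exists x0, forall i, p i <= x0 <= p i + l / 2 ^+ i.
Proof.
move=> l0 hp.
have pS : {homo p : i j / (i <= j)%N >-> i <= j}.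
  by apply: homo_leq => [x|x y z|i]; [exact: lexx|exact: le_trans|have /andP[] := hp i].
have qS : {homo (fun i => - (p i + l / 2 ^+ i)) : i j / (i <= j)%N >-> i <= j}.
  apply: homo_leq => [x|x y z|i]; [exact: lexx|exact: le_trans|].
  have /andP[_ h] := hp i; rewrite lerN2 (le_trans (lerD h (lexx _)))//.
  rewrite -addrA lerD2l exprS.
  have n2 : 2 ^+ i != 0 :> R by rewrite expf_neq0.
  by rewrite le_eqVlt; apply/orP; left; apply/eqP; field.
have pq i j : p j <= p i + l / 2 ^+ i.
  have li k : 0 < l / 2 ^+ k by rewrite divr_gt0// exprn_gt0.
  have [ij|ji] := leqP i j.
    by have := qS _ _ ij; rewrite lerN2; apply: le_trans; rewrite lerDl ltW.
  by rewrite (le_trans (pS _ _ (ltnW ji)))// lerDl ltW.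
have ub i : ubound (range p) (p i + l / 2 ^+ i) by move=> _ [j _ <-]; exact: pq.
have hs : has_sup (range p) by split; [exists (p 0%N), 0%N|exists (p 0%N + l / 2 ^+ 0)].
exists (sup (range p)) => i; apply/andP; split.
  by apply: sup_upper_bound => //; exists i.
by apply: ge_sup => //; case: hs.
Qed.

(** Complex differentiability of [h] at [x0 + i y0], with [h] read in real
    coordinates. *)
Definition cdiff h x0 y0 := exists d : C, forall e : R, 0 < e ->
  exists2 r : R, 0 < r & forall x y, `|x - x0| <= r -> `|y - y0| <= r ->
    rnorm (h x y - (h x0 y0 + d * ((x - x0) +i* (y - y0) : C)))
    <= e * (`|x - x0| + `|y - y0|).

(** If the bound failed, some quarter would fail a quarter of the bound, and so on;
    at the common point of the nested rectangles [h] is affine up to an error that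
    is small compared with the size of the rectangle, and the affine part
    contributes nothing at any level [n]. *)
Lemma goursat h a c l m (e : R) : 0 < l -> 0 < m -> 0 < e ->
  (forall x y, a <= x <= a + l -> c <= y <= c + m -> cdiff h x y) ->
  exists N, forall n, (N <= n)%N -> rnorm (boundary_sum n h a c l m) <= e.
Proof.
move=> l0 m0 e0 hd.
pose L i := l / 2 ^+ i; pose M i := m / 2 ^+ i.
pose good i (p : R * R) := exists N, forall n, (N <= n)%N ->
  rnorm (boundary_sum n h p.1 p.2 (L i) (M i)) <= e / 4 ^+ i.
have LS i : L i.+1 = L i / 2.
  by rewrite /L exprS; field; rewrite expf_neq0.
have MS i : M i.+1 = M i / 2.
  by rewrite /M exprS; field; rewrite expf_neq0.
have L0 i : 0 < L i by rewrite divr_gt0// exprn_gt0.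
have M0 i : 0 < M i by rewrite divr_gt0// exprn_gt0.
pose step i (p p' : R * R) := ~ good i.+1 p' /\
  (p.1 <= p'.1 <= p.1 + L i.+1) /\ (p.2 <= p'.2 <= p.2 + M i.+1).
have ex_step i p : ~ good i p -> exists p', step i p p'.
  move=> bad; apply: contrapT => nex; apply: bad.
  have g p' : p.1 <= p'.1 <= p.1 + L i.+1 -> p.2 <= p'.2 <= p.2 + M i.+1 ->
      good i.+1 p'.
    by move=> h1 h2; apply: contrapT => ng; apply: nex; exists p'.
  have [h1 h1'] : p.1 <= p.1 <= p.1 + L i.+1 /\ p.1 <= p.1 + L i.+1 <= p.1 + L i.+1.
    by rewrite !lexx lerDl (ltW (L0 _)).
  have [h2 h2'] : p.2 <= p.2 <= p.2 + M i.+1 /\ p.2 <= p.2 + M i.+1 <= p.2 + M i.+1.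
    by rewrite !lexx lerDl (ltW (M0 _)).
  have [N1 g1] := g (p.1, p.2) h1 h2.
  have [N2 g2] := g (p.1 + L i.+1, p.2) h1' h2.
  have [N3 g3] := g (p.1, p.2 + M i.+1) h1 h2'.
  have [N4 g4] := g (p.1 + L i.+1, p.2 + M i.+1) h1' h2'.
  exists (maxn (maxn N1 N2) (maxn N3 N4)).+1 => -[//|n].
  rewrite ltnS !geq_max => /andP[/andP[n1 n2] /andP[n3 n4]].
  rewrite boundary_sumS -LS -MS.
  have -> : e / 4 ^+ i = e / 4 ^+ i.+1 + e / 4 ^+ i.+1 + e / 4 ^+ i.+1 + e / 4 ^+ i.+1.
    by rewrite exprS; field; rewrite expf_neq0.
  rewrite (le_trans (rnormD _ _))// lerD//; last exact: g4.
  rewrite (le_trans (rnormD _ _))// lerD//; last exact: g3.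
  by rewrite (le_trans (rnormD _ _))// lerD//; [exact: g1|exact: g2].
apply: contrapT => bad0.
pose F := fix F i := if i is j.+1 then xget (F j) [set p | step j (F j) p] else (a, c).
have badF i : ~ good i (F i).
  elim: i => [|i IH].
    by move=> [N gN]; apply: bad0; exists N => n /gN; rewrite /L /M /= !expr0 !divr1.
  by have [p hp] := ex_step i _ IH; have /= [] := @xgetPex _ (F i) _ (ex_intro _ p hp).
have stepF i : step i (F i) (F i.+1).
  by have [p hp] := ex_step i _ (badF i); exact: (@xgetPex _ (F i) _ (ex_intro _ p hp)).
have [x0 hx0] := nested_intervals l0 (fun i => proj1 (proj2 (stepF i))).
have [y0 hy0] := nested_intervals m0 (fun i => proj2 (proj2 (stepF i))).
have [||d hdd] := hd x0 y0.
- by have := hx0 0%N; rewrite expr0 divr1.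
- by have := hy0 0%N; rewrite expr0 divr1.
(* All rectangles have the same shape, so one relative error suits every scale. *)
pose e' := e / (2 * (l + m) * (l + m)).
have lm : 0 < l + m by rewrite addr_gt0.
have e'0 : 0 < e' by rewrite divr_gt0// mulr_gt0// mulr_gt0.
have [r r0 hr] := hdd _ e'0.
have [i hi] : exists i, (l + m) / 2 ^+ i <= r.
  exists (Num.bound ((l + m) / r)).
  set k := Num.bound _; rewrite ler_pdivrMr ?exprn_gt0// -ler_pdivrMl// mulrC.
  rewrite (le_trans (ltW (archi_boundP _)))// ?divr_ge0 ?(ltW lm) ?(ltW r0)// -natrX ler_nat.
  by rewrite ltnW// ltn_expl.
have LM : L i + M i = (l + m) / 2 ^+ i by rewrite /L /M -mulrDl.
apply: (badF i); exists 0%N => n _.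
(* The remainder of the affine approximation of [h] at the limit point. *)
pose g x y := h x y - (h x0 y0 + d * ((x - x0) +i* (y - y0) : C)).
have -> : h = fun x y => (h x0 y0 + d * ((x - x0) +i* (y - y0) : C)) + g x y.
  by apply/funext => x; apply/funext => y; rewrite /g addrC subrK.
rewrite (boundary_sumD n (fun x y => h x0 y0 + d * ((x - x0) +i* (y - y0) : C)) g).
rewrite boundary_sum_affine add0r.
have -> : e / 4 ^+ i = 2 * (L i + M i) * (e' * (L i + M i)).
  rewrite LM /e' (_ : 4 = 2 * 2 :> R); last by rewrite -natrM.
  by rewrite exprMn; field; rewrite ?expf_neq0 ?gt_eqF.
apply: boundary_sum_le; [exact: ltW|exact: ltW|] => x y hx hy.
have near z z0 w k : 0 < k -> w <= z0 <= w + k -> w <= z <= w + k -> `|z - z0| <= k :> R.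
  by move=> k0 /andP[? ?] /andP[? ?]; rewrite ler_norml; apply/andP; split; lra.
have dx : `|x - x0| <= L i by apply: (near _ _ _ _ (L0 i) (hx0 i)).
have dy : `|y - y0| <= M i by apply: (near _ _ _ _ (M0 i) (hy0 i)).
rewrite (le_trans (hr _ _ _ _))//.
- by rewrite (le_trans dx)// (le_trans _ hi)// -LM lerDl ltW.
- by rewrite (le_trans dy)// (le_trans _ hi)// -LM lerDr ltW.
- by rewrite ler_wpM2l ?lerD// ltW.
Qed.

End goursat.

(** * Derivatives in terms of the modulus, and the complex exponential *)

Lemma diff_littleo (K : numFieldType) (V W : normedModType K) (f : V -> W) x
    (e : K) : differentiable f x -> 0 < e ->
  \forall h \near (0 : V), `|f (x + h) - (f x + 'd f x h)| <= e * `|h|.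
Proof.
move=> /diff_locally/eqaddoP h e0; have := h _ e0.
by apply: filterS => y /=; rewrite !fctE /= (addrC y) opprD addrA.
Qed.

Lemma littleo_diff (K : numFieldType) (V W : normedModType K) (f : V -> W) x
    (D : {linear V -> W}) : continuous D ->
  (forall e : K, 0 < e ->
    \forall h \near (0 : V), `|f (x + h) - (f x + D h)| <= e * `|h|) ->
  differentiable f x.
Proof.
move=> Dc h; have H : f \o shift x = cst (f x) + D +o_ 0 id.
  apply/eqaddoP => e e0; have := h _ e0.
  by apply: filterS => y /=; rewrite !fctE /= (addrC y).
by apply/diff_locallyP; rewrite (diff_unique Dc H); split.
Qed.

Section rnorm_diff.
Context {R : realType}.
Local Notation C := (Cplx R).

Lemma differentiable_rnorm (V W : normedModType R[i]) (f : V -> W) x (e : R) :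
  differentiable f x -> 0 < e -> exists2 r : R, 0 < r & forall y, rnorm (y - x) <= r ->
    rnorm (f y - (f x + 'd f x (y - x))) <= e * rnorm (y - x).
Proof.
move=> df e0; have eC : 0 < e%:C by rewrite ltcR.
have /nbhs_rnorm[r r0 h] := diff_littleo df eC.
exists r => // y yx; have := h (y - x).
by rewrite subr0 => /(_ yx); rewrite subrKC -!rnormE -rmorphM lecR.
Qed.

(** A quadratic remainder is a convenient sufficient condition for
    differentiability: it passes to pointwise limits, unlike a little-o. *)
Lemma rnorm_differentiable (V W : normedModType R[i]) (f : V -> W) x
    (D : {linear V -> W}) (K r : R) : 0 < r -> (forall v, rnorm (D v) <= K * rnorm v) ->
  (forall v, rnorm v <= r -> rnorm (f (x + v) - (f x + D v)) <= K * rnorm v ^+ 2) ->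
  differentiable f x.
Proof.
move=> r0 DK hf; pose K1 := `|K| + 1.
have K10 : 0 < K1 by rewrite ltr_wpDl.
have KK1 : K <= K1 by rewrite (le_trans (ler_norm _))// lerDl.
apply: (@littleo_diff _ _ _ _ _ D).
  apply/linear_bounded_continuous/linear_boundedP.
  exists K1%:C; split; first by rewrite /= ger0_real// ler0c ltW.
  move=> x0; rewrite ltcE => /andP[/eqP Ix /= hx] v.
  rewrite (_ : x0 = (complex.Re x0)%:C); last first.
    rewrite RRe_real//; apply/complex_realP; exists (complex.Re x0).
    by case: x0 Ix {hx} => a b /= ->.
  rewrite -!rnormE -rmorphM lecR (le_trans (DK v))// ler_wpM2r ?rnorm_ge0//.
  by rewrite (le_trans KK1)// ltW.
move=> e; rewrite ltcE => /andP[/eqP /= Ie e0].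
have eE : e = (complex.Re e)%:C by case: e Ie {e0} => a b /= ->.
apply/nbhs_rnorm; exists (Num.min r (complex.Re e / K1)).
  by rewrite lt_min r0 divr_gt0.
move=> v; rewrite subr0 le_min => /andP[vr ve].
rewrite -!rnormE eE -rmorphM lecR (le_trans (hf _ vr))// expr2 mulrA.
rewrite ler_wpM2r ?rnorm_ge0// (@le_trans _ _ (K1 * rnorm v))//.
  by rewrite ler_wpM2r ?rnorm_ge0.
by rewrite mulrC -ler_pdivlMr.
Qed.

Lemma real_differentiable_rnorm (f : R -> R) (d : R) (e : R) :
  is_derive (0 : R) (1 : R) f d -> 0 < e -> exists2 r : R, 0 < r & forall x, `|x| <= r ->
    `|f x - (f 0 + d * x)| <= e * `|x|.
Proof.
move=> [fd fE] e0.
have df : differentiable f 0 by apply/derivable1_diffP.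
have /nbhs_ballP[r /= r0 h] := diff_littleo df e0.
exists (r / 2) => [|x xr]; first by rewrite divr_gt0.
have := h x; rewrite -ball_normE /= sub0r normrN add0r.
rewrite deriv1E// derive1E fE /= => /(_ _); rewrite [x *: d]mulrC; apply.
by rewrite (le_lt_trans xr)// ltr_pdivrMr// ltr_pMr// ltr1n.
Qed.

(** The exponential of [x + i y], by its real and imaginary parts. *)
Definition cexp (x y : R) : C := (expR x * cos y) +i* (expR x * sin y).

Lemma cexpD x x' y y' : cexp (x + x') (y + y') = cexp x y * cexp x' y'.
Proof.
rewrite /cexp expRD cosD sinD.
by apply/eqP; rewrite eq_complex /=; apply/andP; split; apply/eqP; ring.
Qed.

Lemma cexp_real x : cexp x 0 = (expR x)%:C.
Proof. by rewrite /cexp cos0 sin0 mulr1 mulr0. Qed.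

Lemma cexp2pi x : cexp x (2 * pi) = cexp x 0.
Proof. by rewrite /cexp mulr_natl cos2pi sin2pi cos0 sin0. Qed.

Lemma rnorm_cexp x y : rnorm (cexp x y) = expR x.
Proof.
rewrite /rnorm normc_def /= !exprMn -mulrDr cos2Dsin2 mulr1 sqrtr_sqr.
by rewrite ger0_norm// expR_ge0.
Qed.

Lemma cexp_diff0 (e : R) : 0 < e -> exists2 r : R, 0 < r &
  forall x y, `|x| <= r -> `|y| <= r ->
    rnorm (cexp x y - (1 + (x +i* y : C))) <= e * (`|x| + `|y|).
Proof.
move=> e0.
(* The estimates below add up to at most [7 * e1] times the increments. *)
have [e1 [e10 e11 e1e]] : exists e1 : R, [/\ 0 < e1, e1 <= 1 & e1 * 8 <= e].
  exists (Num.min 1 (e / 8)).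
  split; first by rewrite lt_min ltr01 divr_gt0.
    by rewrite ge_min lexx.
  by rewrite -ler_pdivlMr// ge_min lexx orbT.
have [r1 r10 h1] := real_differentiable_rnorm (is_derive_expR 0) e10.
have [r2 r20 h2] := real_differentiable_rnorm (is_derive_sin 0) e10.
have [r3 r30 h3] := real_differentiable_rnorm (is_derive_cos 0) e10.
exists (Num.min (Num.min r1 r2) (Num.min r3 e1)).
  by rewrite !lt_min r10 r20 r30 e10.
move=> x y; rewrite !le_min => /andP[/andP[/h1 x1 _] /andP[_ xe]].
move=> /andP[/andP[_ /h2 y2] /andP[/h3 y3 ye]].
move: x1 y2 y3; rewrite expR0 sin0 cos0 oppr0 mul0r addr0 add0r !mul1r => x1 y2 y3.
have x0 := normr_ge0 x; have y0 := normr_ge0 y.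
have -> : cexp x y - (1 + (x +i* y : C)) =
    (expR x * cos y - (1 + x)) +i* (expR x * sin y - y) :> C.
  by apply/eqP; rewrite eq_complex /=; apply/andP; split; apply/eqP; ring.
rewrite (le_trans (rnorm_complex _ _))//.
have c1 := cos_max y; have s1 := sin_max y.
have E : `|expR x - 1| <= 2 * `|x|.
  have -> : expR x - 1 = (expR x - (1 + x)) + x by ring.
  rewrite (le_trans (ler_normD _ _))//; have := ler_wpM2r x0 e11; lra.
have A : `|expR x * cos y - (1 + x)| <= e1 * `|x| + 2 * (e1 * `|y|).
  have -> : expR x * cos y - (1 + x) = (expR x - (1 + x)) * cos y + (1 + x) * (cos y - 1).
    by ring.
  rewrite (le_trans (ler_normD _ _))// lerD// normrM.
    by rewrite -[leRHS]mulr1 ler_pM.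
  rewrite ler_pM//; rewrite (le_trans (ler_normD _ _))// normr1; lra.
have B : `|expR x * sin y - y| <= (2 * e1) * (2 * `|y|) + e1 * `|y|.
  have -> : expR x * sin y - y = (expR x - 1) * sin y + (sin y - y) by ring.
  rewrite (le_trans (ler_normD _ _))// lerD// normrM ler_pM//.
    by rewrite (le_trans E)// ler_wpM2l.
  have -> : sin y = (sin y - y) + y by ring.
  rewrite (le_trans (ler_normD _ _))//; have := ler_wpM2r y0 e11; lra.
rewrite (le_trans (lerD A B))//.
have := ler_wpM2r x0 e1e; have := ler_wpM2r y0 e1e.
have := mulr_ge0 (ltW e10) x0; have := mulr_ge0 (ltW e10) y0.
rewrite mulrDr; lra.
Qed.

End rnorm_diff.

(** * Means over roots of unity *)

Section circle_mean.
Context {R : realType}.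
Local Notation C := (Cplx R).
Implicit Types (G H : C -> C) (n : nat) (l w : C).

(** The exponential carries rectangles to annular sectors, so that the Goursat lemma
    can be used on an annulus. *)
Lemma cdiff_cexp G x0 y0 : differentiable G (cexp x0 y0) ->
  cdiff (fun x y => G (cexp x y)) x0 y0.
Proof.
set l0 : C := cexp x0 y0 => dG.
have Dlin (v : C) : 'd G l0 v = v * 'd G l0 1.
  by rewrite -[in LHS](mulr1 v) -[v * 1]/(v *: (1 : C)) linearZ.
pose d : C := 'd G l0 1; exists (d * l0) => e e0.
pose A := rnorm d * rnorm l0; pose B := rnorm l0.
have A0 : 0 <= A by rewrite mulr_ge0 ?rnorm_ge0.
have B0 : 0 <= B by rewrite rnorm_ge0.
have [e2 [e20 e21 e2e]] : exists e2 : R, [/\ 0 < e2, e2 <= 1 & A * e2 <= e / 2].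
  have A1 : 0 < A + 1 by rewrite ltr_wpDl.
  exists (Num.min 1 (e / 2 / (A + 1))); split.
  - by rewrite lt_min ltr01 !divr_gt0.
  - by rewrite ge_min lexx.
  - rewrite (@le_trans _ _ ((A + 1) * (e / 2 / (A + 1))))//.
      rewrite ler_pM ?lerDl// ?ge_min ?lexx ?orbT//.
      by rewrite le_min ler01 !divr_ge0// ltW.
    by rewrite mulrCA divff ?mulr1 ?gt_eqF.
have [e1 e10 e1e] : exists2 e1 : R, 0 < e1 & e1 * (2 * B) <= e / 2.
  have B1 : 0 < 2 * B + 1 by rewrite ltr_wpDl// mulr_ge0.
  exists (e / 2 / (2 * B + 1)); first by rewrite !divr_gt0.
  by rewrite mulrAC ler_pdivrMr// ler_wpM2l ?divr_ge0 ?(ltW e0)// lerDl.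
have [r1 r10 h1] := differentiable_rnorm dG e10.
have [r2 r20 h2] := cexp_diff0 (R := R) e20.
have B1 : 0 < 4 * B + 1 by rewrite ltr_wpDl// mulr_ge0.
exists (Num.min r2 (r1 / (4 * B + 1))); first by rewrite lt_min r20 divr_gt0.
move=> x y; rewrite !le_min => /andP[x2 x1] /andP[y2 y1].
set s := x - x0 in x1 x2 *; set t := y - y0 in y1 y2 *.
have E : cexp x y = l0 * cexp s t by rewrite -cexpD !subrKC.
have N : rnorm (s +i* t : C) <= `|s| + `|t| := rnorm_complex _ _.
have S0 : 0 <= `|s| + `|t| by rewrite addr_ge0.
have M : cexp x y - l0 = l0 * (s +i* t : C) + l0 * (cexp s t - (1 + (s +i* t : C))).
  by rewrite E; ring.
have P := h2 _ _ x2 y2.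
have Q : rnorm (cexp x y - l0) <= 2 * B * (`|s| + `|t|).
  rewrite M (le_trans (rnormD _ _))// !rnormM -mulrDr (mulrC 2) -mulrA ler_wpM2l//.
  by rewrite mulr_natl mulr2n lerD// (le_trans P)// ler_piMl.
have {}h1 := h1 (cexp x y).
rewrite Dlin -/d in h1.
have -> : G (cexp x y) - (G l0 + d * l0 * (s +i* t : C)) =
    (G (cexp x y) - (G l0 + (cexp x y - l0) * d)) +
    d * l0 * (cexp s t - (1 + (s +i* t : C))).
  by rewrite M; ring.
rewrite (le_trans (rnormD _ _))// (splitr e) (mulrDl (e / 2)) lerD//; last first.
  rewrite !rnormM -/A (le_trans (ler_wpM2l A0 P))// mulrA ler_wpM2r//.
rewrite (le_trans (h1 _))//.
  rewrite (le_trans Q)// (@le_trans _ _ (2 * B * (r1 / (4 * B + 1) *+ 2)))//.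
    by rewrite ler_wpM2l ?mulr_ge0// mulr2n lerD.
  have -> : 2 * B * (r1 / (4 * B + 1) *+ 2) = (4 * B) * r1 / (4 * B + 1).
    by rewrite mulr2n; field; rewrite gt_eqF.
  by rewrite ler_pdivrMr// mulrC ler_wpM2l ?lerDl// ltW.
rewrite (le_trans (ler_wpM2l (ltW e10) Q))//.
by rewrite !mulrA -(mulrA _ _ B) ler_wpM2r.
Qed.

(** Since [cexp 0 t] runs over the [2 ^ n]-th roots of unity, this is the average of
    [G] over them. *)
Definition mean n G : C :=
  ((2 * pi)^-1)%:C * left_sum n (fun t => G (cexp 0 t)) 0 (2 * pi).

Let pi2_gt0 : 0 < 2 * pi :> R.
Proof. by rewrite mulr_gt0// pi_gt0. Qed.

Let pi2_ge0 : 0 <= 2 * pi :> R := ltW pi2_gt0.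

Let pi2V_ge0 : 0 <= (2 * pi)^-1 :> R.
Proof. by rewrite invr_ge0. Qed.

Lemma mean_eq n G H : (forall l, rnorm l = 1 -> G l = H l) -> mean n G = mean n H.
Proof.
move=> GH; rewrite /mean; congr (_ * left_sum _ _ _ _).
by apply/funext => t; apply: GH; rewrite rnorm_cexp expR0.
Qed.

Lemma meanD n G H : mean n (fun l => G l + H l) = mean n G + mean n H.
Proof. by rewrite /mean left_sumD mulrDr. Qed.

Lemma meanZ n w G : mean n (fun l => w * G l) = w * mean n G.
Proof. by rewrite /mean /left_sum -mulr_sumr; ring. Qed.

Lemma mean_cst n w : mean n (fun=> w) = w.
Proof.
by rewrite /mean left_sum_cst mulrA -rmorphM /= mulVf ?gt_eqF// mul1r.
Qed.

Lemma mean_le n G M : (forall l, rnorm l = 1 -> rnorm (G l) <= M) ->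
  rnorm (mean n G) <= M.
Proof.
move=> GM; rewrite rnormM rnorm_real ger0_norm ?pi2V_ge0//.
rewrite ler_pdivrMl//; apply: left_sum_le; first exact: ltW.
by move=> t _; apply: GM; rewrite rnorm_cexp expR0.
Qed.

(** The real part of [H] serves as a nonnegative majorant of [G]; this is how the
    positivity of the Fejer kernel is used. *)
Lemma mean_Re n G H : (forall l, rnorm l = 1 -> rnorm (G l) <= complex.Re (H l)) ->
  rnorm (mean n G) <= complex.Re (mean n H).
Proof.
move=> GH.
have ReM (r : R) (w : C) : complex.Re (r%:C * w : C) = r * complex.Re w.
  by case: w => a b /=; rewrite mul0r subr0.
have ReS N (F : 'I_N -> C) : complex.Re (\sum_(i < N) F i) = \sum_(i < N) complex.Re (F i).
  by elim/big_ind2 : _ => [//|x1 x2 y1 y2 <- <-|//]; case: x2; case: y2.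
rewrite /mean /left_sum rnormM ReM rnorm_real ger0_norm ?pi2V_ge0//.
rewrite ler_wpM2l ?pi2V_ge0// rnormM ReM rnorm_real ger0_norm; last first.
  by rewrite divr_ge0 ?exprn_ge0.
rewrite ler_wpM2l ?divr_ge0 ?exprn_ge0// ReS.
rewrite (le_trans (rnorm_sum _ _ _))// ler_sum// => k _.
by apply: GH; rewrite rnorm_cexp expR0.
Qed.

(** The logarithm of the annulus is a rectangle of height [2 * pi]; its horizontal
    sides carry the same values and cancel, and its vertical sides give the two
    means. *)
Lemma mean_radius G (s e : R) : 0 < s <= 1 -> 0 < e ->
  (forall l, s <= rnorm l <= 1 -> differentiable G l) ->
  exists N, forall n, (N <= n)%N ->
    rnorm (mean n G - mean n (fun l => G (s%:C * l))) <= e.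
Proof.
move=> /andP[s0]; rewrite le_eqVlt => /predU1P[->|s1] e0 dG.
  exists 0%N => n _; rewrite [X in _ - X](_ : _ = mean n G).
    by rewrite subrr rnorm0 ltW.
  by apply: mean_eq => l _; rewrite mul1r.
have lns : ln s < 0 by rewrite ln_lt0// s0.
have [| | | |N hN] := @goursat R (fun x y => G (cexp x y)) (ln s) 0 (- ln s) (2 * pi) (2 * pi * e).
- by rewrite oppr_gt0.
- exact: pi2_gt0.
- by rewrite mulr_gt0.
- move=> x y; rewrite subrr => /andP[sx x0] _; apply: cdiff_cexp; apply: dG.
  by rewrite rnorm_cexp -[s]lnK ?posrE// ler_expR sx /= -expR0 ler_expR.
exists N => n /hN; rewrite /boundary_sum subrr add0r.
under [X in left_sum n X _ _ - _]eq_fun do rewrite -cexp2pi.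
rewrite subrr add0r rnormM rnormi mul1r => h.
rewrite /mean -mulrBr rnormM rnorm_real ger0_norm ?pi2V_ge0//.
rewrite ler_pdivrMl//.
rewrite [X in _ - left_sum n X _ _](_ : _ = fun t => G (cexp (ln s) t))//.
apply/funext => t; congr G.
by rewrite -[in LHS](lnK (x := s)) ?posrE// -cexp_real -cexpD addr0 add0r.
Qed.

End circle_mean.

(** * Circle means and Taylor coefficients *)

(** An ultrafilter containing all eventual properties of natural numbers.  Limits along
    it exist for all bounded sequences, so that the convergence of Riemann sums
    never has to be discussed. *)
Definition nat_ultra : set_system nat :=
  sval (cid (ultraFilterLemma (eventually_filter : ProperFilter \oo))).

#[global] Instance nat_ultra_ultra : UltraFilter nat_ultra.
Proof. by rewrite /nat_ultra; case: cid => U []. Qed.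

Lemma nat_ultra_eventually (P : set nat) N :
  (forall n, (N <= n)%N -> P n) -> nat_ultra P.
Proof.
move=> NP; rewrite /nat_ultra; case: cid => U [UU /= sU]; apply: sU.
by exists N.
Qed.

Section limit_mean.
Context {R : realType}.
Local Notation C := (Cplx R).
Implicit Types (G H : C -> C) (n : nat) (l w : C) (M s : R).

Definition circle_bnd G := exists M, forall l, rnorm l = 1 -> rnorm (G l) <= M.

(** This plays the role of the integral of [G] over the unit circle with respect to
    the normalized arc length. *)
Definition lim_mean G : C := lim (mean n G @[n --> nat_ultra]).

Lemma lim_mean_cvg G : circle_bnd G -> mean n G @[n --> nat_ultra] --> lim_mean G.
Proof.
move=> [M GM].
have [c hc] : exists c : C, mean n G @[n --> nat_ultra] --> c.
  apply: (@ultra_cvg _ _ _ _ _ M); apply: (@nat_ultra_eventually _ 0%N) => n _.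
  exact: mean_le.
exact: cvgP hc.
Qed.

Lemma lim_mean_unique G w : circle_bnd G ->
  mean n G @[n --> nat_ultra] --> w -> lim_mean G = w.
Proof. by move=> /lim_mean_cvg Gl Gw; exact: cvg_unique_rnorm Gl Gw. Qed.

Lemma circle_bndD G H : circle_bnd G -> circle_bnd H -> circle_bnd (fun l => G l + H l).
Proof.
move=> [M GM] [N HN]; exists (M + N) => l l1.
by rewrite (le_trans (rnormD _ _))// lerD ?GM ?HN.
Qed.

Lemma circle_bndM G H : circle_bnd G -> circle_bnd H -> circle_bnd (fun l => G l * H l).
Proof.
move=> [M GM] [N HN]; exists (M * N) => l l1.
by rewrite rnormM ler_pM ?rnorm_ge0 ?GM ?HN.
Qed.

Lemma circle_bnd_cst w : circle_bnd (fun=> w).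
Proof. by exists (rnorm w). Qed.

Lemma circle_bndX n : circle_bnd (fun l => l ^+ n).
Proof. by exists 1 => l l1; rewrite rnormX l1 expr1n. Qed.

Lemma circle_bndV n : circle_bnd (fun l => l^-1 ^+ n).
Proof. by exists 1 => l l1; rewrite rnormX rnormV l1 invr1 expr1n. Qed.

Lemma circle_bnd_sum I (r : seq I) (F : I -> C -> C) :
  (forall i, circle_bnd (F i)) -> circle_bnd (fun l => \sum_(i <- r) F i l).
Proof.
move=> FB; elim: r => [|i r IH].
  by exists 0 => l _; rewrite big_nil rnorm0.
by under eq_fun do rewrite big_cons; apply: circle_bndD.
Qed.

Lemma lim_mean_eq G H : (forall l, rnorm l = 1 -> G l = H l) -> lim_mean G = lim_mean H.
Proof.
move=> GH; rewrite /lim_mean (_ : mean^~ G = mean^~ H)//.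
by apply/funext => n; exact: mean_eq.
Qed.

Lemma lim_meanD G H : circle_bnd G -> circle_bnd H ->
  lim_mean (fun l => G l + H l) = lim_mean G + lim_mean H.
Proof.
move=> bG bH; apply: lim_mean_unique; first exact: circle_bndD.
rewrite (_ : mean^~ _ = fun n => mean n G + mean n H); last first.
  by apply/funext => n; exact: meanD.
exact: cvgD (lim_mean_cvg bG) (lim_mean_cvg bH).
Qed.

Lemma lim_meanZ w G : circle_bnd G -> lim_mean (fun l => w * G l) = w * lim_mean G.
Proof.
move=> bG; apply: lim_mean_unique; first exact: circle_bndM (circle_bnd_cst w) bG.
rewrite (_ : mean^~ _ = fun n => w * mean n G); last first.
  by apply/funext => n; exact: meanZ.
exact: cvgM (cvg_cst w) (lim_mean_cvg bG).
Qed.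

Lemma lim_mean_cst w : lim_mean (fun=> w) = w.
Proof.
apply: lim_mean_unique; first exact: circle_bnd_cst.
rewrite (_ : mean^~ _ = fun=> w); first exact: cvg_cst.
by apply/funext => n; exact: mean_cst.
Qed.

Lemma lim_mean_sum I (r : seq I) (F : I -> C -> C) : (forall i, circle_bnd (F i)) ->
  lim_mean (fun l => \sum_(i <- r) F i l) = \sum_(i <- r) lim_mean (F i).
Proof.
move=> FB; elim: r => [|i r IH].
  rewrite big_nil -[RHS](lim_mean_cst 0); apply: lim_mean_eq => l _; exact: big_nil.
rewrite big_cons -IH -lim_meanD//; last exact: circle_bnd_sum.
by apply: lim_mean_eq => l _; rewrite big_cons.
Qed.

Lemma lim_mean_le G M : (forall l, rnorm l = 1 -> rnorm (G l) <= M) ->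
  rnorm (lim_mean G) <= M.
Proof.
move=> GM; apply: (@cvg_rnorm_le _ _ _ nat_ultra _ (fun n => mean n G)).
  by apply: lim_mean_cvg; exists M.
by apply: (@nat_ultra_eventually _ 0%N) => n _; exact: mean_le.
Qed.

Lemma lim_mean_Re G H : circle_bnd G -> circle_bnd H ->
  (forall l, rnorm l = 1 -> rnorm (G l) <= complex.Re (H l)) ->
  rnorm (lim_mean G) <= complex.Re (lim_mean H).
Proof.
move=> bG bH GH; apply/ler_addgt0Pl => e e0.
apply: (@cvg_rnorm_le _ _ _ nat_ultra _ (fun n => mean n G)).
  exact: lim_mean_cvg.
have /cvg_rnorm /(_ _ e0) := lim_mean_cvg bH.
apply: filterS => n /= Hn; rewrite (le_trans (mean_Re _ GH))//.
rewrite -lerBlDr (le_trans _ Hn)// (le_trans _ (rnorm_Re _))//.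
by case: (mean n H) (lim_mean H) => a b [c d] /=; rewrite ler_norm.
Qed.

Lemma lim_mean_radius G s : 0 < s <= 1 ->
  (forall l, s <= rnorm l <= 1 -> differentiable G l) ->
  circle_bnd G -> circle_bnd (fun l => G (s%:C * l)) ->
  lim_mean G = lim_mean (fun l => G (s%:C * l)).
Proof.
move=> s01 dG bG bGs; apply: lim_mean_unique => //.
apply/cvg_rnorm => e e0; have e2 : 0 < e / 2 by rewrite divr_gt0.
have [N hN] := mean_radius s01 e2 dG.
have /cvg_rnorm /(_ _ e2) := lim_mean_cvg bGs.
have : nat_ultra [set n | rnorm (mean n G - mean n (fun l => G (s%:C * l))) <= e / 2].
  exact: nat_ultra_eventually hN.
apply: filterS2 => n /= h1 h2.
by rewrite (le_trans (rnorm_triangle (mean n (fun l => G (s%:C * l))) _ _))// (splitr e) lerD.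
Qed.

Lemma differentiable_mulr w l : differentiable (fun z : C => w * z) l.
Proof. exact: (@differentiableZ R[i] C C (fun z : C => z) w). Qed.

Lemma differentiable_comp_mulr G w l :
  differentiable G (w * l) -> differentiable (fun z : C => G (w * z)) l.
Proof.
move=> dG; have h : differentiable (G \o (fun z : C => w * z)) l.
  by apply: differentiable_comp; [exact: differentiable_mulr|].
exact: h.
Qed.

Lemma differentiable_exp n l : differentiable (fun z : C => z ^+ n) l.
Proof.
case: n => [|n]; first exact: differentiable_cst.
have := @differentiableX R[i] C (fun z : C => z) n l.
by rewrite exprfctE; exact.
Qed.

Lemma differentiable_expV n l : l != 0 -> differentiable (fun z : C => z^-1 ^+ n) l.
Proof.
move=> l0; have h : differentiable ((fun z : C => z ^+ n) \o (GRing.inv : C -> C)) l.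
  apply: differentiable_comp; last exact: differentiable_exp.
  exact: (@differentiable_Rinv R[i]).
exact: h.
Qed.

(** The hypotheses of the Cauchy estimates on the closed unit disc. *)
Definition disc_bnd (g : C -> C) M :=
  forall l, rnorm l <= 1 -> differentiable g l /\ rnorm (g l) <= M.

Implicit Types g : C -> C.

(** The Taylor coefficient of degree [j] of [g] at [0], as a Fourier coefficient on
    the unit circle. *)
Definition coef j g := lim_mean (fun l => g l * l^-1 ^+ j).

Lemma disc_bnd_ge0 g M : disc_bnd g M -> 0 <= M.
Proof.
by move=> gM; have [|_] := gM 0; rewrite ?rnorm0//; apply: le_trans; exact: rnorm_ge0.
Qed.

Lemma disc_circle g M : disc_bnd g M -> circle_bnd g.
Proof. by move=> gM; exists M => l l1; apply: (gM l _).2; rewrite l1. Qed.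

Lemma disc_scale g M s : 0 < s <= 1 -> disc_bnd g M -> disc_bnd (fun l => g (s%:C * l)) M.
Proof.
move=> /andP[s0 s1] gM l l1; have [|dg gl] := gM (s%:C * l).
  by rewrite rnormM rnorm_real gtr0_norm// mulr_ile1 ?rnorm_ge0// ltW.
by split; [exact: differentiable_comp_mulr|exact: gl].
Qed.

Lemma coef_le j g M : disc_bnd g M -> rnorm (coef j g) <= M.
Proof.
move=> gM; apply: lim_mean_le => l l1.
by rewrite rnormM rnormX rnormV l1 invr1 expr1n mulr1; apply: (gM l _).2; rewrite l1.
Qed.

Lemma coef_bnd j g : circle_bnd g -> circle_bnd (fun l => g l * l^-1 ^+ j).
Proof. by move=> bg; apply: circle_bndM => //; exact: circle_bndV. Qed.

Lemma coef_scale j g M s : 0 < s <= 1 -> disc_bnd g M ->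
  coef j (fun l => g (s%:C * l)) = s%:C ^+ j * coef j g.
Proof.
move=> s01 gM; have /andP[s0 s1] := s01.
have sN0 : s%:C != 0 :> R[i] by rewrite gt_eqF// ltcR.
have gsM := disc_scale s01 gM.
rewrite {2}/coef (@lim_mean_radius _ s)//; first last.
- under eq_fun do rewrite invfM exprMn mulrCA.
  by apply: circle_bndM (circle_bnd_cst _) (coef_bnd _ (disc_circle gsM)).
- exact: coef_bnd (disc_circle gM).
- move=> l /andP[sl l1]; have [dg _] := gM l l1.
  apply: (differentiableM dg); apply: differentiable_expV.
  by rewrite -rnorm_gt0 (lt_le_trans s0).
under [X in lim_mean X]eq_fun do rewrite invfM exprMn mulrCA.
rewrite lim_meanZ; last exact: coef_bnd (disc_circle gsM).
by rewrite mulrA -exprMn divff// expr1n mul1r.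
Qed.

(** Shrinking the circle to radius [s] multiplies the coefficient of degree
    [- j.+1] by a positive power of [s], while the function stays bounded. *)
Lemma coef_neg j g M : disc_bnd g M -> lim_mean (fun l => g l * l ^+ j.+1) = 0.
Proof.
move=> gM; have M0 := disc_bnd_ge0 gM.
apply: rnorm_le_eps => e e0.
pose s := Num.min 1 (e / (M + 1)).
have s0 : 0 < s by rewrite lt_min ltr01 divr_gt0// ltr_wpDl.
have s1 : s <= 1 by rewrite ge_min lexx.
have s01 : 0 < s <= 1 by rewrite s0.
have gsM := disc_scale s01 gM.
rewrite (@lim_mean_radius _ s)//; first last.
- under eq_fun do rewrite exprMn mulrCA.
  by apply: circle_bndM (circle_bnd_cst _) (circle_bndM (disc_circle gsM) (circle_bndX _)).
- exact: circle_bndM (disc_circle gM) (circle_bndX _).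
- move=> l /andP[sl l1]; have [dg _] := gM l l1.
  exact: (differentiableM dg (differentiable_exp _ _)).
apply: lim_mean_le => l l1.
rewrite rnormM rnormX rnormM l1 mulr1 rnorm_real gtr0_norm//.
rewrite (@le_trans _ _ (M * s))//.
  rewrite ler_pM ?rnorm_ge0 ?exprn_ge0 ?(ltW s0)//; first by apply: (gsM l _).2; rewrite l1.
  by rewrite exprS ler_piMr ?(ltW s0)// exprn_ile1// ltW.
have M1 : 0 < M + 1 by rewrite ltr_wpDl.
rewrite (@le_trans _ _ ((M + 1) * (e / (M + 1))))//.
  by rewrite ler_pM// ?(ltW s0)// ?lerDl// ge_min lexx orbT.
by rewrite mulrCA divff ?mulr1// gt_eqF.
Qed.

End limit_mean.

(** * Fejer summation *)

Section fejer.
Context {R : realType}.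
Local Notation C := (Cplx R).
Implicit Types (g G H : C -> C) (n : nat) (l w : C) (M s : R).

(** The Cesaro mean of order [J] of the series with terms [c]. *)
Definition fejer_sum (c : nat -> C) J : C :=
  (J%:R^-1)%:C * \sum_(b < J) \sum_(i < b.+1) c i.

(** The Fejer kernel, as the product of a geometric sum and its conjugate. *)
Definition fejer J l : C :=
  (J%:R^-1)%:C * ((\sum_(a < J) l ^+ a) * (\sum_(b < J) l^-1 ^+ b)).

Lemma disc_bnd_cst w : disc_bnd (fun=> w) (rnorm w).
Proof. by move=> l _; split; [exact: differentiable_cst|]. Qed.

(** Coefficients of negative degree vanish, which makes the Fejer mean of the Fourier
    series of [g] a mean of partial sums of its Taylor series. *)
Lemma lim_mean_exp (a b : nat) g M : disc_bnd g M ->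
  lim_mean (fun l => g l * (l ^+ a * l^-1 ^+ b)) = if (a <= b)%N then coef (b - a) g else 0.
Proof.
have l0 l : rnorm l = 1 -> l != 0 by move=> l1; rewrite -rnorm_gt0 l1.
move=> gM; case: leqP => ab.
  apply: lim_mean_eq => l /l0 ?; congr (_ * _).
  by rewrite -[in LHS](subnK ab) exprD mulrCA -exprMn divff// expr1n mulr1.
rewrite -[RHS](coef_neg (a - b).-1 gM); apply: lim_mean_eq => l /l0 ?; congr (_ * _).
rewrite prednK ?subn_gt0// -[in LHS](subnK (ltnW ab)) exprD -mulrA -exprMn.
by rewrite divff// expr1n mulr1.
Qed.

Lemma circle_bnd_fejer J : circle_bnd (fejer J).
Proof.
apply: circle_bndM (circle_bnd_cst _) (circle_bndM _ _); apply: circle_bnd_sum => i.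
  exact: circle_bndX.
exact: circle_bndV.
Qed.

Lemma sum_le_sub J b (c : nat -> C) : (b < J)%N ->
  \sum_(a < J) (if (a <= b)%N then c (b - a)%N else 0) = \sum_(i < b.+1) c i.
Proof.
move=> bJ.
rewrite -(big_mkord xpredT (fun a => if (a <= b)%N then c (b - a)%N else 0)).
rewrite (big_cat_nat _ bJ)//= [X in _ + X]big_nat_cond [X in _ + X]big1 ?addr0; last first.
  by move=> i /andP[/andP[bi _] _]; rewrite leqNgt bi.
rewrite big_nat_rev /= add0n -(big_mkord xpredT c).
apply: eq_big_nat => i /andP[_ ib].
by rewrite subSS leq_subr subKn.
Qed.

Lemma lim_mean_fejer J g M : disc_bnd g M ->
  lim_mean (fun l => g l * fejer J l) = fejer_sum (coef^~ g) J.
Proof.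
move=> gM; have bg := disc_circle gM.
transitivity (lim_mean (fun l => (J%:R^-1)%:C *
    \sum_(b < J) \sum_(a < J) g l * (l ^+ a * l^-1 ^+ b))).
  apply: lim_mean_eq => l _; rewrite /fejer mulrCA; congr (_ * _).
  rewrite mulr_sumr mulr_sumr; apply: eq_bigr => b _.
  by rewrite mulr_suml mulr_sumr.
have b1 (a b : nat) : circle_bnd (fun l => g l * (l ^+ a * l^-1 ^+ b)).
  exact: circle_bndM bg (circle_bndM (circle_bndX _) (circle_bndV _)).
have b2 (b : nat) : circle_bnd (fun l => \sum_(a < J) g l * (l ^+ a * l^-1 ^+ b)).
  exact: circle_bnd_sum.
rewrite lim_meanZ; last exact: circle_bnd_sum.
rewrite lim_mean_sum// /fejer_sum; congr (_ * _); apply: eq_bigr => b _.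
rewrite lim_mean_sum//.
under eq_bigr do rewrite (lim_mean_exp _ _ gM).
exact: (sum_le_sub (coef^~ g)).
Qed.

Lemma fejerE J l : rnorm l = 1 ->
  fejer J l = (J%:R^-1 * rnorm (\sum_(a < J) l ^+ a) ^+ 2)%:C.
Proof.
move=> l1.
have lJ : l^-1 = l^*%C :> C by rewrite invc_norm -(rnormE (l : C)) l1 rmorph1 expr1n invr1 mul1r.
rewrite /fejer.
have -> : \sum_(b < J) l^-1 ^+ b = (\sum_(a < J) l ^+ a)^*%C :> C.
  by rewrite lJ rmorph_sum; apply: eq_bigr => i _; rewrite rmorphXn.
by rewrite -sqr_normc -(rnormE (_ : C)) -rmorphXn -rmorphM.
Qed.


(** The constant function [1] has no Taylor coefficient of positive degree: by
    [coef_scale] such a coefficient is a proper fraction of itself. *)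
Lemma lim_mean_fejer1 J : (0 < J)%N -> lim_mean (fejer J) = 1.
Proof.
move=> J0.
have c0 i : coef i (fun=> 1) = (if i == 0%N then 1 else 0) :> C.
  case: i => [|i] /=.
    by rewrite /coef; under lim_mean_eq do rewrite expr0 mulr1; exact: lim_mean_cst.
  have h01 : 0 < (2^-1 : R) <= 1 by lra.
  have /eqP := coef_scale i.+1 h01 (disc_bnd_cst 1).
  rewrite -subr_eq0 -{1}[coef _ _]mul1r -mulrBl mulf_eq0 => /orP[|/eqP//].
  rewrite -rmorphXn subr_eq0 => /eqP /complexI h.
  have : 2^-1 ^+ i.+1 < 1 :> R by rewrite exprn_ilt1//; lra.
  by rewrite -h ltxx.
have := lim_mean_fejer J (disc_bnd_cst 1).
under lim_mean_eq do rewrite mul1r; move=> ->.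
rewrite /fejer_sum; under eq_bigr do under eq_bigr do rewrite c0.
under eq_bigr do rewrite big_ord_recl big1 ?addr0//.
rewrite sumr_const card_ord /= (_ : 1 *+ J = (J%:R)%:C); last by rewrite rmorph_nat.
by rewrite -rmorphM mulVf// pnatr_eq0 -lt0n.
Qed.

(** On the unit circle [|l - 1|^2 * fejer J l = |l^J - 1|^2 / J <= 4 / J], and
    [|l - 1| <= eta / 2 + |l - 1|^2 / (2 * eta)]; averaging the two against the
    kernel gives the rate without splitting the circle. *)
Lemma fejer_approx g M (L eta : R) J : (0 < J)%N -> disc_bnd g M -> 0 <= L -> 0 < eta ->
  (forall l, rnorm l = 1 -> rnorm (g l - g 1) <= L * rnorm (l - 1)) ->
  rnorm (fejer_sum (coef^~ g) J - g 1) <= L * (eta / 2 + 2 / (eta * J%:R)).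
Proof.
move=> J0 gM L0 eta0 gL.
have J0' : 0 < J%:R :> R by rewrite ltr0n.
have bF := circle_bnd_fejer J.
have bg := disc_circle gM.
pose H l : C := (L * (eta / 2))%:C * fejer J l + (L * (2 / (eta * J%:R)))%:C.
have bH : circle_bnd H.
  exact: circle_bndD (circle_bndM (circle_bnd_cst _) bF) (circle_bnd_cst _).
have -> : fejer_sum (coef^~ g) J - g 1 = lim_mean (fun l => (g l - g 1) * fejer J l).
  have E : lim_mean (fun l => - g 1 * fejer J l) = - g 1.
    by rewrite lim_meanZ// lim_mean_fejer1// mulr1.
  rewrite -(lim_mean_fejer J gM) -[in LHS]E -lim_meanD.
  - by apply: lim_mean_eq => l _; rewrite mulrDl.
  - exact: circle_bndM.
  - exact: circle_bndM (circle_bnd_cst _) bF.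
have -> : L * (eta / 2 + 2 / (eta * J%:R)) = complex.Re (lim_mean H).
  rewrite /H lim_meanD; [|exact: circle_bndM (circle_bnd_cst _) bF|exact: circle_bnd_cst].
  by rewrite lim_meanZ// lim_mean_fejer1// lim_mean_cst mulr1 /= mulrDr.
apply: lim_mean_Re => //.
  exact: circle_bndM (circle_bndD bg (circle_bnd_cst _)) bF.
move=> l l1; rewrite rnormM /H (fejerE _ l1) -rmorphM -rmorphD /= rnorm_real.
set S := rnorm (\sum_(a < J) _).
have S0 : 0 <= S by exact: rnorm_ge0.
have K0 : 0 <= J%:R^-1 * S ^+ 2 by rewrite mulr_ge0 ?invr_ge0 ?exprn_ge0 ?ler0n.
rewrite ger0_norm// -(mulrA L (eta / 2)) -mulrDr.
rewrite (le_trans (ler_wpM2r K0 (gL _ l1)))// -(mulrA L) ler_wpM2l//.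
set d := rnorm (l - 1).
have d0 : 0 <= d by exact: rnorm_ge0.
have dS : (d * S) ^+ 2 <= 4.
  have dS2 : d * S <= 2.
    rewrite -rnormM -subrX1 (le_trans (rnormD _ _))// rnormN rnorm1 rnormX l1 expr1n.
    by rewrite -[1 + 1](natrD _ 1 1).
  rewrite (_ : 4 = 2 ^+ 2 :> R); last by rewrite -natrX.
  by rewrite ler_pXn2r ?nnegrE ?mulr_ge0.
have dd : d <= eta / 2 + d ^+ 2 / (2 * eta).
  have : 0 <= (d - eta) ^+ 2 / (2 * eta) by rewrite divr_ge0 ?sqr_ge0// mulr_ge0// ltW.
  suff -> : (d - eta) ^+ 2 / (2 * eta) = eta / 2 + d ^+ 2 / (2 * eta) - d by lra.
  by field; rewrite gt_eqF.
rewrite (le_trans (ler_wpM2r K0 dd))// mulrDl lerD2l.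
have -> : d ^+ 2 / (2 * eta) * (J%:R^-1 * S ^+ 2) = (d * S) ^+ 2 / (2 * eta * J%:R).
  by field; rewrite !gt_eqF.
have -> : 2 / (eta * J%:R) = 4 / (2 * eta * J%:R).
  by field; rewrite !gt_eqF.
by rewrite ler_wpM2r// invr_ge0 !mulr_ge0// ltW.
Qed.

(** A choice of [eta] and then of [J] making the error of [fejer_approx] small,
    together with an error of the form [K / J]. *)
Lemma fejer_rate (K L e : R) : 0 <= K -> 0 <= L -> 0 < e -> exists (J : nat) (eta : R),
  [/\ (0 < J)%N, 0 < eta & K / J%:R + L * (eta / 2 + 2 / (eta * J%:R)) <= e].
Proof.
move=> K0 L0 e0; have L1 : 0 < L + 1 by rewrite ltr_wpDl.
pose eta := e / (L + 1); have eta0 : 0 < eta by rewrite divr_gt0.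
have Q0 : 0 <= (K + L * (2 / eta)) / (e / 2).
  rewrite divr_ge0 ?(addr_ge0 K0) ?(mulr_ge0 L0)//; first by rewrite divr_ge0 ?(ltW eta0).
  by rewrite divr_ge0 ?(ltW e0).
exists (Num.bound ((K + L * (2 / eta)) / (e / 2))).+1, eta; split=> //.
set J := (Num.bound _).+1.
have J0 : 0 < J%:R :> R by rewrite ltr0n.
have hJ : (K + L * (2 / eta)) / J%:R <= e / 2.
  rewrite ler_pdivrMr// -ler_pdivrMl ?divr_gt0// [leLHS]mulrC.
  by rewrite (le_trans (ltW (archi_boundP Q0)))// ler_nat.
rewrite (_ : K / _ + _ = L * eta / 2 + (K + L * (2 / eta)) / J%:R); last first.
  by field; rewrite !gt_eqF.
rewrite (splitr e) lerD//.
by rewrite ler_wpM2r// /eta mulrCA ler_piMr ?(ltW e0)// ler_pdivrMr// mul1r lerDl.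
Qed.

End fejer.

(** * Second-order Taylor estimate on the disc *)

Section taylor.
Context {R : realType}.
Local Notation C := (Cplx R).
Implicit Types (g : C -> C) (l w : C) (M s : R).

(** Near [1] this is differentiability, and away from [1] boundedness.  The constant
    depends on [g] in an uncontrolled way, but disappears in the limit taken in
    [taylor_coef]. *)
Lemma disc_lipschitz1 g M : disc_bnd g M -> exists2 L : R, 0 <= L &
  forall l, rnorm l = 1 -> rnorm (g l - g 1) <= L * rnorm (l - 1).
Proof.
move=> gM; have M0 := disc_bnd_ge0 gM.
have [|dg g1] := gM 1; first by rewrite rnorm1.
have [r r0 hr] := differentiable_rnorm dg ltr01.
pose d : C := 'd g (1 : C) (1 : C).
have d0 : 0 <= rnorm d by exact: rnorm_ge0.
have Mr : 0 <= 2 * M / r by rewrite divr_ge0 ?mulr_ge0// ltW.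
exists (rnorm d + 1 + 2 * M / r); first by rewrite !addr_ge0.
move=> l l1; have l10 : 0 <= rnorm (l - 1) by exact: rnorm_ge0.
have [lr|lr] := leP (rnorm (l - 1)) r.
  apply: (@le_trans _ _ ((rnorm d + 1) * rnorm (l - 1))); last first.
    by rewrite ler_wpM2r// lerDl.
  have E : 'd g (1 : C) (l - 1) = (l - 1) * d.
    by rewrite -[in LHS](mulr1 (l - 1)) -[(l - 1) * 1]/((l - 1) *: (1 : C)) linearZ.
  have := hr l lr; rewrite E => h.
  have -> : g l - g 1 = (g l - (g 1 + (l - 1) * d)) + (l - 1) * d by ring.
  rewrite (le_trans (rnormD _ _))// rnormM (mulrDl (rnorm d)) addrC.
  by rewrite (mulrC (rnorm d)) lerD2l.
apply: (@le_trans _ _ (2 * M)).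
  rewrite (le_trans (rnormD _ _))// rnormN mulr_natl mulr2n lerD//.
  by apply: (gM l _).2; rewrite l1.
rewrite -[leLHS](divfK (lt0r_neq0 r0)) ler_pM// ?(ltW r0) ?(ltW lr)//.
by rewrite lerDr addr_ge0.
Qed.

Lemma sum_geometric s n : 0 <= s < 1 -> \sum_(i < n) s ^+ i <= (1 - s)^-1.
Proof.
move=> /andP[s0 s1]; have s1' : 0 < 1 - s by rewrite subr_gt0.
rewrite -[leRHS]mul1r ler_pdivlMr// mulrC -opprB mulNr -subrX1 opprB.
by rewrite lerBlDr lerDl exprn_ge0.
Qed.

(** Only the first partial sum may be off by [K], and it has weight [1 / J] in the
    mean. *)
Lemma fejer_sum_near (c : nat -> C) w (T K : R) J : (0 < J)%N -> 0 <= T ->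
  rnorm (c 0%N - w) <= K ->
  (forall b, rnorm (\sum_(i < b.+2) c i - w) <= T) ->
  rnorm (fejer_sum c J - w) <= T + K / J%:R.
Proof.
case: J => // J _ T0 hK hT.
have J0 : 0 < J.+1%:R :> R by rewrite ltr0n.
have -> : fejer_sum c J.+1 - w =
    (J.+1%:R^-1)%:C * \sum_(b < J.+1) (\sum_(i < b.+1) c i - w).
  rewrite big_split sumr_const card_ord /= mulrDr /fejer_sum; congr (_ + _).
  rewrite (_ : (- w) *+ J.+1 = (J.+1%:R)%:C * (- w)); last by rewrite rmorph_nat mulr_natl.
  by rewrite mulrA -rmorphM mulVf ?gt_eqF// mul1r.
rewrite rnormM rnorm_real ger0_norm ?invr_ge0 ?ler0n//.
rewrite ler_pdivrMl// mulrDr mulrCA divff ?gt_eqF// mulr1.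
rewrite (le_trans (rnorm_sum _ _ _))// big_ord_recl /= big_ord_recl big_ord0 addr0 addrC lerD//.
rewrite (@le_trans _ _ (\sum_(i < J) T))//; first by apply: ler_sum => i _; exact: hT.
by rewrite sumr_const card_ord -(mulr_natl T) ler_wpM2r// ler_nat.
Qed.

(** The partial sums of the Taylor series at [s] of order at least one are within
    the tail of a geometric series of the affine part, hence so are their
    means, which converge to [g s]. *)
Lemma taylor_coef g M s : disc_bnd g M -> 0 < s < 1 ->
  rnorm (g s%:C - (coef 0 g + s%:C * coef 1 g)) <= M * s ^+ 2 / (1 - s).
Proof.
move=> gM /andP[s0 s1]; have M0 := disc_bnd_ge0 gM.
have s01 : 0 < s <= 1 by rewrite s0 ltW.
have s1' : 0 < 1 - s by rewrite subr_gt0.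
have gsM := disc_scale s01 gM.
have [L L0 hL] := disc_lipschitz1 gsM.
set T := M * s ^+ 2 / (1 - s).
have T0 : 0 <= T by rewrite !mulr_ge0 ?invr_ge0 ?exprn_ge0// ltW.
set w := coef 0 g + s%:C * coef 1 g.
pose c i : C := coef i (fun l => g (s%:C * l)).
have cE i : c i = s%:C ^+ i * coef i g by exact: coef_scale gM.
pose K := rnorm (c 0%N - w).
have hT b : rnorm (\sum_(i < b.+2) c i - w) <= T.
  rewrite !big_ord_recl /= !cE /= expr0 expr1 mul1r addrA -/w addrAC subrr add0r.
  rewrite (le_trans (rnorm_sum _ _ _))//.
  rewrite (@le_trans _ _ (\sum_(i < b) (M * s ^+ 2) * s ^+ i))//.
    apply: ler_sum => i _; rewrite cE rnormM rnormX rnorm_real gtr0_norm//.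
    by rewrite -mulrA -exprD mulrC ler_pM ?rnorm_ge0 ?exprn_ge0 ?(coef_le _ gM)// ltW.
  by rewrite -mulr_sumr ler_wpM2l ?mulr_ge0 ?exprn_ge0 ?sum_geometric ?(ltW s0).
apply/ler_addgt0Pl => e e0.
have [J [eta [J0 eta0 hJ]]] := fejer_rate (rnorm_ge0 (c 0%N - w)) L0 e0.
have A := fejer_approx J0 gsM L0 eta0 hL.
have B := @fejer_sum_near c w T K J J0 T0 (lexx _) hT.
rewrite mulr1 in A.
rewrite (le_trans (rnorm_triangle (fejer_sum c J) _ _))// rnorm_distC.
by rewrite (le_trans (lerD A B))// addrCA addrC lerD2r addrC.
Qed.

(** Letting [s] tend to [0] in [taylor_coef] identifies the first two coefficients
    with the value and the derivative at [0]. *)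
Lemma taylor_bound g M : disc_bnd g M ->
  rnorm ('d g (0 : C) (1 : C)) <= M /\
  (forall s, 0 <= s <= 2^-1 ->
    rnorm (g s%:C - (g 0 + s%:C * 'd g (0 : C) (1 : C))) <= 2 * M * s ^+ 2).
Proof.
move=> gM; have M0 := disc_bnd_ge0 gM.
have [|dg g0] := gM 0; first by rewrite rnorm0.
pose d : C := 'd g (0 : C) (1 : C).
have E (l : C) : 'd g (0 : C) l = l * d.
  by rewrite -[in LHS](mulr1 l) -[l * 1]/(l *: (1 : C)) linearZ.
have h s : 0 < s <= 2^-1 ->
    rnorm (g s%:C - (coef 0 g + s%:C * coef 1 g)) <= 2 * M * s ^+ 2.
  move=> /andP[s0 s1].
  rewrite (le_trans (taylor_coef gM _))//; first by rewrite s0 /=; lra.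
  rewrite ler_pdivrMr; last by lra.
  rewrite (_ : 2 * M * s ^+ 2 * (1 - s) = M * s ^+ 2 * (2 * (1 - s))); last by ring.
  by rewrite ler_peMr ?mulr_ge0 ?exprn_ge0 ?(ltW s0)//; lra.
(* Two affine approximations with quadratic and little-o errors must coincide. *)
pose a : C := coef 0 g - g 0; pose b : C := coef 1 g - d.
have ab e : 0 < e -> exists2 r : R, 0 < r &
    forall s, 0 < s <= r -> rnorm (a + s%:C * b) <= 2 * M * s ^+ 2 + e * s.
  move=> e0; have [r r0 hr] := differentiable_rnorm dg e0.
  exists (Num.min r 2^-1); first by rewrite lt_min r0 invr_gt0 ltr0n.
  move=> s; rewrite le_min => /and3P[s0 sr s2].
  have {}hr : rnorm (g s%:C - (g 0 + s%:C * d)) <= e * s.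
    have := hr s%:C; rewrite subr0 E rnorm_real gtr0_norm//; exact.
  have -> : a + s%:C * b = (g s%:C - (g 0 + s%:C * d)) - (g s%:C - (coef 0 g + s%:C * coef 1 g)).
    by rewrite /a /b; ring.
  by rewrite (le_trans (rnormD _ _))// rnormN addrC lerD// h// s0.
have B0 := rnorm_ge0 b.
have a0 : a = 0.
  apply: rnorm_le_eps => e e0; have [r r0 hr] := ab _ (ltr01).
  pose k := 2 * M + 1 + rnorm b.
  have k0 : 0 < k by rewrite ltr_wpDr// ltr_wpDl// mulr_ge0.
  pose s := Num.min (Num.min r 1) (e / k).
  have s0 : 0 < s by rewrite !lt_min r0 ltr01 divr_gt0.
  have /= := hr s; rewrite s0 !ge_min lexx => /(_ isT) hs.
  have s1 : s <= 1 by rewrite !ge_min lexx orbT.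
  have se : s * k <= e by rewrite -ler_pdivlMr// ge_min lexx orbT.
  have -> : a = (a + s%:C * b) - s%:C * b by rewrite addrK.
  rewrite (le_trans (rnormD _ _))// rnormN rnormM rnorm_real gtr0_norm//.
  rewrite (le_trans (lerD hs (lexx _)))// (le_trans _ se)// /k.
  have := ler_wpM2l (mulr_ge0 (ler0n R 2) M0) (ler_wpM2l (ltW s0) s1).
  rewrite -expr2; lra.
have b0 : b = 0.
  apply: rnorm_le_eps => e e0; have e2 : 0 < e / 2 by rewrite divr_gt0.
  have [r r0 hr] := ab _ e2.
  pose s := Num.min r (e / 2 / (2 * M + 1)).
  have M1 : 0 < 2 * M + 1 by rewrite ltr_wpDl// mulr_ge0.
  have s0 : 0 < s by rewrite lt_min r0 divr_gt0.
  have /= := hr s; rewrite s0 ge_min lexx a0 add0r rnormM rnorm_real gtr0_norm// => /(_ isT).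
  rewrite (_ : 2 * M * s ^+ 2 + e / 2 * s = s * (2 * M * s + e / 2)); last by ring.
  rewrite ler_pM2l// => /le_trans; apply; rewrite [leRHS]splitr lerD2r.
  have : s * (2 * M + 1) <= e / 2 by rewrite -ler_pdivlMr// ge_min lexx orbT.
  lra.
move/eqP: a0; rewrite subr_eq0 => /eqP a0; move/eqP: b0; rewrite subr_eq0 => /eqP b0.
split; first by rewrite -/d -b0; exact: coef_le.
move=> s /andP[]; rewrite le_eqVlt => /predU1P[<- _|s0 s1].
  by rewrite mul0r addr0 subrr rnorm0 expr0n mulr0.
by rewrite -/d -a0 -b0 h// s0.
Qed.

End taylor.

(** * Holomorphic functions on a ball of a normed space *)

Section ball.
Context {R : realType} {V : normedModType R[i]}.
Local Notation C := (Cplx R).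
Implicit Types (f : V -> C) (x u v : V) (l : C) (M r : R).

Lemma is_diff_line x u l :
  is_diff l (fun k : C => x + k *: u) (fun k : C => k *: u).
Proof.
have h : is_diff l (cst x + (fun k : C => k *: u)) (0 + (fun k : C => k *: u)).
  exact: is_diffD.
by rewrite add0r in h.
Qed.

Lemma differentiable_line f x u l : differentiable f (x + l *: u) ->
  differentiable (fun k : C => f (x + k *: u)) l.
Proof.
move=> df; have [dh _] := is_diff_line x u l.
exact: (differentiable_comp dh df).
Qed.

Lemma diff_line f x u l (k : C) : differentiable f (x + l *: u) ->
  'd (fun k : C => f (x + k *: u)) l k = 'd f (x + l *: u) (k *: u).
Proof.
move=> df; have [dh hE] := is_diff_line x u l.
have := diff_comp dh df.
by rewrite hE => /(congr1 (fun F => F k)).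
Qed.

Definition ball_bnd f x r M := forall y, rnorm (y - x) <= r ->
  differentiable f y /\ rnorm (f y) <= M.

(** Apply [taylor_bound] on the complex line through [x] in the direction of [v],
    scaled to fit the unit disc. *)
Lemma ball_taylor f x r M : 0 < r -> ball_bnd f x r M ->
  (forall v, rnorm ('d f x v) <= M / r * rnorm v) /\
  (forall v, rnorm v <= r / 2 ->
    rnorm (f (x + v) - (f x + 'd f x v)) <= 2 * M / r ^+ 2 * rnorm v ^+ 2).
Proof.
move=> r0 fM.
have [|df0 f0] := fM x; first by rewrite subrr rnorm0 ltW.
have scale v : v != 0 -> exists u,
    [/\ disc_bnd (fun l : C => f (x + l *: u)) M, v = (rnorm v / r)%:C *: u
     & 'd (fun l : C => f (x + l *: u)) (0 : C) (1 : C) = 'd f x u].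
  move=> v0; have nv : rnorm v != 0 by rewrite gt_eqF// rnorm_gt0.
  have rn0 : r != 0 by rewrite gt_eqF.
  exists ((r / rnorm v)%:C *: v); split.
  - move=> l l1; have [|df fM'] := fM (x + l *: ((r / rnorm v)%:C *: v)).
      rewrite [x + _]addrC addrK rnormZ rnormZ rnorm_real ger0_norm; last first.
        by rewrite divr_ge0 ?rnorm_ge0 ?(ltW r0).
      by rewrite divfK// ler_piMl ?(ltW r0).
    by split; [exact: differentiable_line|exact: fM'].
  - rewrite scalerA -rmorphM /= (_ : _ * _ = 1); last by field; rewrite nv.
    by rewrite scale1r.
  - by rewrite diff_line ?scale0r ?addr0// scale1r.
split=> v; have [->|v0] := eqVneq v 0.
- by rewrite linear0 !rnorm0 mulr0.
- have [u [uM vu dE]] := scale _ v0.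
  have [h _] := taylor_bound uM; rewrite dE in h.
  rewrite {1}vu linearZ rnormZ rnorm_real ger0_norm ?divr_ge0 ?rnorm_ge0 ?(ltW r0)//.
  rewrite (_ : M / r * rnorm v = rnorm v / r * M); last by ring.
  by rewrite ler_wpM2l ?divr_ge0 ?rnorm_ge0 ?(ltW r0).
- by rewrite linear0 !addr0 subrr !rnorm0 expr0n mulr0.
move=> vr; have [u [uM vu dE]] := scale _ v0.
have [_ h] := taylor_bound uM.
have {h} := h (rnorm v / r); rewrite divr_ge0 ?rnorm_ge0 ?(ltW r0)//=.
rewrite ler_pdivrMr// mulrC => /(_ vr); rewrite dE scale0r addr0 -vu.
rewrite -[_%:C * _]/(_%:C *: _) -linearZ -vu.
rewrite expr_div_n (_ : 2 * M * _ = 2 * M / r ^+ 2 * rnorm v ^+ 2)//.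
by rewrite mulrCA mulrA mulrC mulrA mulrAC; ring.
Qed.

Lemma ball_bnd_ge0 f x r M : 0 < r -> ball_bnd f x r M -> 0 <= M.
Proof.
move=> r0 fM; have [|_] := fM x; first by rewrite subrr rnorm0 ltW.
exact/le_trans/rnorm_ge0.
Qed.

Lemma ball_lipschitz f x r M v : 0 < r -> ball_bnd f x r M ->
  rnorm v <= r / 2 -> rnorm (f (x + v) - f x) <= 2 * M / r * rnorm v.
Proof.
move=> r0 fM vr; have M0 := ball_bnd_ge0 r0 fM.
have [h1 h2] := ball_taylor r0 fM.
have -> : f (x + v) - f x = (f (x + v) - (f x + 'd f x v)) + 'd f x v by ring.
rewrite (le_trans (rnormD _ _))// (le_trans (lerD (h2 _ vr) (h1 v)))//.
rewrite (_ : 2 * M / r * rnorm v = M / r * rnorm v + M / r * rnorm v); last by ring.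
rewrite lerD2r (_ : 2 * M / r ^+ 2 * _ = M / r * rnorm v * (2 * rnorm v / r)); last first.
  by field; rewrite gt_eqF.
rewrite ler_piMr ?mulr_ge0 ?invr_ge0 ?rnorm_ge0 ?(ltW r0)//.
by rewrite ler_pdivrMr// mul1r mulrC -ler_pdivlMr.
Qed.

(** The derivatives at [x] of the functions [F n] are uniformly bounded linear maps,
    so they have a pointwise limit which is again linear and bounded, and the
    uniform quadratic remainder of [ball_taylor] passes to the limit. *)
Lemma ball_bnd_limit (F : nat -> V -> C) f x r M : 0 < r ->
  (forall n, ball_bnd (F n) x r M) ->
  (forall y, rnorm (y - x) <= r -> F n y @[n --> nat_ultra] --> f y) ->
  differentiable f x.
Proof.
move=> r0 FM Ff; have M0 := ball_bnd_ge0 r0 (FM 0%N).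
have hF n := ball_taylor r0 (FM n).
pose D v : C := lim ('d (F n) x v @[n --> nat_ultra]).
have cD v : ('d (F n) x v : C) @[n --> nat_ultra] --> D v.
  have [c hc] : exists c : C, ('d (F n) x v : C) @[n --> nat_ultra] --> c.
    apply: (@ultra_cvg _ _ _ _ _ (M / r * rnorm v)).
    by apply: (@nat_ultra_eventually _ 0%N) => n _; exact: (hF n).1.
  exact: cvgP hc.
have Dlin : linear D.
  move=> a u v; apply: (@cvg_unique_rnorm R C _ nat_ultra _ _ _ _ (cD _)).
  rewrite (_ : (fun n => _) = fun n => a *: ('d (F n) x u : C) + 'd (F n) x v); last first.
    by apply/funext => n; rewrite linearP.
  apply: cvgD; last exact: cD.
  by apply: cvgZl_tmp; exact: cD.
pose D' : {linear V -> C} := HB.pack D (GRing.isLinear.Build _ _ _ _ D Dlin).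
pose K := Num.max (M / r) (2 * M / r ^+ 2).
apply: (@rnorm_differentiable R V C f x D' K (r / 2)); first by rewrite divr_gt0.
  move=> v; apply: (@cvg_rnorm_le _ _ _ nat_ultra _ _ _ _ (cD v)).
  apply: (@nat_ultra_eventually _ 0%N) => n _ /=.
  by rewrite (le_trans ((hF n).1 v))// ler_wpM2r ?rnorm_ge0// le_max lexx.
move=> v vr.
have Fc : (F n (x + v) - (F n x + 'd (F n) x v) : C) @[n --> nat_ultra] -->
    (f (x + v) - (f x + D v) : C).
  apply: cvgB; first apply: Ff.
    by rewrite [x + _]addrC addrK (le_trans vr)// ler_pdivrMr// ler_pMr// ler1n.
  by apply: cvgD; [apply: Ff; rewrite subrr rnorm0 ltW|exact: cD].
apply: (@cvg_rnorm_le _ _ _ nat_ultra _ _ _ _ Fc).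
apply: (@nat_ultra_eventually _ 0%N) => n _ /=.
by rewrite (le_trans ((hF n).2 v vr))// ler_wpM2r ?exprn_ge0 ?rnorm_ge0// le_max lexx orbT.
Qed.

End ball.

(** * Sets at a positive distance from the boundary *)

Section Ubounded_sets.
Context {R : realType}.
Local Notation C := (Cplx R).

Lemma bounded_rnormP (T : Type) (W : normedModType R[i]) (f : T -> W) (A : set T) :
  [bounded f x | x in A] <-> exists M : R, forall x, A x -> rnorm (f x) <= M.
Proof.
split=> [/pinfty_ex_gt0[M M0 h]|[M h]].
  by exists (complex.Re M) => x Ax; rewrite rnorm_le RRe_real ?gtr0_real//; exact: h.
exists M%:C; split; first by apply/complex_realP; exists M.
move=> y; rewrite ltcE => /andP[/eqP Iy /= My] x Ax.
rewrite (_ : y = (complex.Re y)%:C); last by case: y Iy {My} => a b /= ->.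
by rewrite -rnorm_le (le_trans (h _ Ax))// ltW.
Qed.

Context {X : normedModType R[i]}.
Implicit Types (U A : set X) (x y : X).

(** Take the last point of the segment from [x] to [y] that is a limit of points of
    the segment in [U]. *)
Lemma boundary_crossing U x y : open U -> U x -> ~ U y ->
  exists2 z, boundary U z & rnorm (x - z) <= rnorm (x - y).
Proof.
move=> oU Ux Uy; pose p (t : R) := x + t%:C *: (y - x).
pose T := [set t : R | 0 <= t <= 1 /\ U (p t)].
have p0 : p 0 = x by rewrite /p scale0r addr0.
have p1 : p 1 = y by rewrite /p scale1r subrKC.
have T0 : T 0 by split; [rewrite lexx ler01|rewrite p0].
have hs : has_sup T by split; [exists 0|exists 1 => t [/andP[]]].
pose t0 := sup T.
have t00 : 0 <= t0 by exact: sup_upper_bound.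
have t01 : t0 <= 1 by apply: ge_sup; [exists 0|move=> t [/andP[]]].
have pd s t : rnorm (p s - p t) = `|s - t| * rnorm (y - x).
  rewrite /p opprD addrACA subrr add0r -scalerBl -rmorphB rnormZ rnorm_real//.
have yx0 : 0 < rnorm (y - x).
  by rewrite rnorm_gt0 subr_eq0; apply/eqP => yx; apply: Uy; rewrite yx.
exists (p t0); last first.
  by rewrite -[X in X - _]p0 pd sub0r normrN ger0_norm// rnorm_distC ler_piMl// rnorm_ge0.
split.
  move=> S /nbhs_rnorm[e e0 hS].
  have ed : 0 < e / rnorm (y - x) by rewrite divr_gt0.
  have [t Tt ht] := sup_adherent ed hs.
  exists (p t); split; first by case: Tt.
  apply: hS; rewrite pd -ler_pdivlMr// ler_norml; apply/andP; split.
    by rewrite -/t0 in ht; lra.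
  have : t <= t0 by exact: sup_upper_bound.
  by lra.
rewrite (interior_id U).1// => Upt0.
have /nbhs_rnorm[e e0 hU] := open_nbhs_nbhs (conj oU Upt0).
have t1 : t0 < 1.
  by rewrite lt_neqAle t01 andbT; apply/eqP => t1; apply: Uy; rewrite -p1 -t1.
pose d := Num.min (1 - t0) (e / rnorm (y - x)).
have d0 : 0 < d by rewrite lt_min subr_gt0 t1 divr_gt0.
have d1 : d <= 1 - t0 by rewrite ge_min lexx.
have de : d <= e / rnorm (y - x) by rewrite ge_min lexx orbT.
have : T (t0 + d).
  split; first by apply/andP; split; lra.
  by apply: hU; rewrite pd [t0 + d]addrC addrK gtr0_norm// -ler_pdivlMr.
by move/(sup_upper_bound hs); rewrite -/t0; lra.
Qed.

(** A segment leaving [U] crosses the boundary, so a positive distance to the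
    boundary is a uniform radius of balls contained in [U]. *)
Lemma Ubounded_ball U A : open U -> Ubounded U A -> exists K d : R,
  [/\ 0 <= K, 0 < d, forall x, A x -> rnorm x <= K &
      forall x y, A x -> rnorm (y - x) < d -> U y].
Proof.
move=> oU [/bounded_rnormP[K hK] AU dA].
have [d d0 hd] : exists2 d : R, 0 < d & (d%:E <= set_dist A (boundary U))%E.
  case: (set_dist A (boundary U)) dA => [r| |] // r0.
    by exists r.
  by exists 1 => //; rewrite leey.
exists `|K|, d; split=> //.
  by move=> x Ax; rewrite (le_trans (hK _ Ax))// ler_norm.
move=> x y Ax yx; apply: contrapT => nUy.
have [z bz xz] := boundary_crossing oU (AU _ Ax) nUy.
have : (set_dist A (boundary U) <= (rnorm (x - z))%:E)%E.
  by apply: ereal_inf_lbound; exists (x, z).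
move=> /(le_trans hd); rewrite lee_fin => /le_trans/(_ xz).
by rewrite rnorm_distC leNgt yx.
Qed.

Lemma ball_Ubounded U A (K d : R) : open U -> 0 < d ->
  (forall x, A x -> rnorm x <= K) ->
  (forall x y, A x -> rnorm (y - x) < d -> U y) -> Ubounded U A.
Proof.
move=> oU d0 hK hd; split.
- by apply/bounded_rnormP; exists K.
- by move=> x Ax; apply: (hd x) => //; rewrite subrr rnorm0.
- apply: (@lt_le_trans _ _ d%:E); first by rewrite lte_fin.
  apply: le_ereal_inf_tmp => _ [[x z] [/= Ax [_ nz]] <-].
  rewrite lee_fin leNgt; apply/negP => xz; apply: nz.
  by rewrite (interior_id U).1//; apply: (hd x); rewrite// rnorm_distC.
Qed.

Lemma Ubounded_subT U A : Ubounded U A -> Ubounded setT A.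
Proof.
move=> [bA _ _]; split => //.
rewrite /boundary interiorT setDT /set_dist setX0 image_set0 ereal_inf0.
exact: ltry.
Qed.

Lemma UboundedT A (K : R) : (forall x, A x -> rnorm x <= K) -> Ubounded setT A.
Proof. by move=> AK; apply: (@ball_Ubounded _ _ K 1) => //; exact: openT. Qed.

Section balanced_open.
Context (U : set X) (U0 : U !=set0) (bU : balanced U) (oU : open U).

Lemma balancedZ (a : C) x : rnorm a <= 1 -> U x -> U (a *: x).
Proof.
move=> a1 Ux; apply: (bU (a := a)); last by exists x.
by rewrite -(rnormE (a : C)) -[1]/(1%:C) lecR.
Qed.

Lemma balanced0 : U 0.
Proof. by have [x Ux] := U0; rewrite -(scale0r x); apply: balancedZ; rewrite ?rnorm0. Qed.

(** The balanced hull of a [U]-bounded set, even slightly enlarged, is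
    [U]-bounded: when [a] is not small, the ball of radius [d] about [x] in [U] is
    carried by [a] to a ball about [a *: x] in [U], and when [a] is small the point
    [a *: x] lies well inside a ball about the origin. *)
Lemma Ubounded_hull A : Ubounded U A -> exists2 d : R, 0 < d &
  Ubounded U [set y | exists x (a : C), [/\ A x, rnorm a <= 1 & rnorm (y - a *: x) <= d]].
Proof.
move=> /(Ubounded_ball oU)[K [d [K0 d0 hK hd]]].
have /nbhs_rnorm[r r0 hr] := open_nbhs_nbhs (conj oU balanced0).
pose q := r / (2 * (K + 1)).
have K1 : 0 < K + 1 by rewrite ltr_wpDl.
have q0 : 0 < q by rewrite divr_gt0// mulr_gt0.
pose e := Num.min (r / 2) (q * d).
have e0 : 0 < e by rewrite lt_min divr_gt0//= mulr_gt0.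
have er : e <= r / 2 by rewrite ge_min lexx.
have eq : e <= q * d by rewrite ge_min lexx orbT.
have thick x (a : C) y : A x -> rnorm a <= 1 -> rnorm (y - a *: x) < e -> U y.
  move=> Ax a1 ya; have [aq|aq] := leP (rnorm a) q.
    apply: hr; rewrite subr0 -[y](subrK (a *: x)) (le_trans (rnormD _ _))//.
    rewrite rnormZ (splitr r) lerD//; first by rewrite (le_trans (ltW ya)).
    rewrite (@le_trans _ _ (q * (K + 1)))//.
      by rewrite ler_pM ?rnorm_ge0// (le_trans (hK _ Ax))// lerDl.
    by rewrite /q le_eqVlt; apply/orP; left; apply/eqP; field; rewrite gt_eqF.
  have a0 : 0 < rnorm a by rewrite (lt_trans q0).
  have aN : a != 0 by rewrite -rnorm_gt0.
  rewrite -[y]scale1r -(divff aN) -scalerA; apply: balancedZ => //.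
  apply: (hd x) => //.
  rewrite -[X in _ - X]scale1r -(mulVf aN) -scalerA -scalerBr rnormZ rnormV.
  rewrite ltr_pdivrMl// (lt_le_trans ya)// (le_trans eq)// ler_wpM2r// ltW//.
exists (e / 2); first by rewrite divr_gt0.
apply: (@ball_Ubounded _ _ (K + e) (e / 2)) => //; first by rewrite divr_gt0.
  move=> y [x [a [Ax a1 ya]]]; rewrite -[y](subrK (a *: x)) addrC (le_trans (rnormD _ _))//.
  rewrite lerD//; last by rewrite (le_trans ya)// ler_pdivrMr// ler_peMr ?ler1n// ltW.
  by rewrite rnormZ (le_trans _ (hK _ Ax))// ler_piMl ?rnorm_ge0.
move=> y z [x [a [Ax a1 ya]]] zy; apply: (thick x a) => //.
rewrite (le_lt_trans (rnorm_triangle y _ _))// [ltRHS]splitr.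
by rewrite ltr_leD.
Qed.

End balanced_open.
End Ubounded_sets.

(** * Density of the entire functions of bounded type *)

Section Hb_algebra.
Context {R : realType} {X : normedModType R[i]}.
Local Notation C := (Cplx R).
Implicit Types (U A : set X) (f g : X -> C).

Lemma HbP U f : Hb U f <-> (forall x, U x -> differentiable f x) /\
  forall A, Ubounded U A -> exists M : R, forall x, A x -> rnorm (f x) <= M.
Proof.
by split=> -[df bf]; split=> // A AU; [apply/bounded_rnormP|apply/bounded_rnormP]; exact: bf.
Qed.

Lemma Hb_cst U (w : C) : Hb U (fun=> w).
Proof.
apply/HbP; split=> [x _|A _]; first exact: differentiable_cst.
by exists (rnorm w).
Qed.

Lemma HbD U f g : Hb U f -> Hb U g -> Hb U (f + g).
Proof.
move=> /HbP[df bf] /HbP[dg bg]; apply/HbP; split=> [x Ux|A AU].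
  by apply: differentiableD; [exact: df|exact: dg].
have [M fM] := bf A AU; have [N gN] := bg A AU; exists (M + N) => x Ax.
by rewrite fctE (le_trans (rnormD _ _))// lerD ?fM ?gN.
Qed.

Lemma HbM U f g : Hb U f -> Hb U g -> Hb U (fun x => f x * g x).
Proof.
move=> /HbP[df bf] /HbP[dg bg]; apply/HbP; split=> [x Ux|A AU].
  exact: differentiableM (df x Ux) (dg x Ux).
have [M fM] := bf A AU; have [N gN] := bg A AU; exists (M * N) => x Ax.
by rewrite rnormM ler_pM ?rnorm_ge0 ?fM ?gN.
Qed.

Lemma HbZ U (a : R[i]) f : Hb U f -> Hb U (a *: f).
Proof. by move=> Uf; exact: (HbM (Hb_cst U a) Uf). Qed.

Lemma HbB U f g : Hb U f -> Hb U g -> Hb U (f - g).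
Proof.
move=> Uf Ug; have -> : f - g = f + (-1 : R[i]) *: g by rewrite scaleN1r.
exact: HbD Uf (HbZ (-1) Ug).
Qed.

Lemma Hb_sum U n (F : 'I_n -> X -> C) : (forall i, Hb U (F i)) ->
  Hb U (fun x => \sum_(i < n) F i x).
Proof.
move=> UF; elim: n F UF => [|n IH] F UF.
  by under eq_fun do rewrite big_ord0; exact: Hb_cst.
by under eq_fun do rewrite big_ord_recr /=; apply: HbD => //; exact: IH.
Qed.

Lemma Hb_subT U f : Hb setT f -> Hb U f.
Proof.
move=> /HbP[df bf]; apply/HbP; split=> [x _|A /Ubounded_subT]; first exact: df.
exact: bf.
Qed.

Lemma Hb_compZ f (a : C) : Hb setT f -> Hb setT (fun x => f (a *: x)).
Proof.
move=> /HbP[df bf]; apply/HbP; split=> [x _|A [/bounded_rnormP[K AK] _ _]].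
  have h : differentiable (f \o (fun x : X => a *: x)) x.
    apply: differentiable_comp; last exact: df.
    exact: (@differentiableZ R[i] X X (fun x : X => x) a).
  exact: h.
have [|M fM] := bf [set a *: x | x in A].
  apply: (@UboundedT _ _ _ (rnorm a * K)) => _ [x Ax <-].
  by rewrite rnormZ ler_wpM2l ?rnorm_ge0 ?AK.
by exists M => x Ax; apply: fM; exists x.
Qed.

Lemma Hb_dual U (l : dual X) : Hb U l.
Proof.
apply: Hb_subT; apply/HbP; split=> [x _|A [/bounded_rnormP[K AK] _ _]].
  apply: (@linear_differentiable R[i] X C l); exact: dual_continuous.
have /linear_bounded_continuous/linear_boundedP/pinfty_ex_gt0[M M0 lM] := @dual_continuous _ _ l.
exists (complex.Re M * K) => x Ax.
have M0' : 0 <= complex.Re M by rewrite -lecR RRe_real ?gtr0_real// ltW.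
rewrite (@le_trans _ _ (complex.Re M * rnorm x))//; last by rewrite ler_wpM2l ?AK.
by rewrite -lecR rmorphM /= !rnormE RRe_real ?gtr0_real//; exact: lM.
Qed.

End Hb_algebra.

Section density.
Context {R : realType} {X : normedModType R[i]}.
Local Notation C := (Cplx R).
Implicit Types (f g : X -> C) (x : X) (s M r : R) (n j : nat).

Definition slice_coef f j x : C := coef j (fun l : C => f (l *: x)).

(** The homogeneous term of degree [j] of the Taylor series of [f] at the origin.
    The function [f] is known on the ball of radius [r] only, so the coefficient is
    taken at a multiple of [x] in that ball and rescaled by homogeneity. *)
Definition taylor_term f r j x : C :=
  ((r / (rnorm x + 1))%:C^-1) ^+ j * slice_coef f j ((r / (rnorm x + 1))%:C *: x).

Context (U : set X) (U0 : U !=set0) (bU : balanced U) (oU : open U).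
Context (f : X -> C) (Uf : Hb U f).

Lemma orbit_disc_bnd x : U x -> exists M, disc_bnd (fun l : C => f (l *: x)) M.
Proof.
move=> Ux; have [df bf] := (HbP U f).1 Uf.
have [d d0 hd] : exists2 d : R, 0 < d & forall y, rnorm (y - x) <= d -> U y.
  by apply/nbhs_rnorm; exact: open_nbhs_nbhs.
have Ax : Ubounded U [set x].
  apply: (@ball_Ubounded _ _ _ _ (rnorm x) d) => //; first by move=> _ ->.
  by move=> _ y -> /ltW; exact: hd.
have [e e0 /bf[M hM]] := Ubounded_hull U0 bU oU Ax.
exists M => l l1; split.
  have h := @differentiable_line R X f 0 x l.
  under eq_fun do rewrite -(add0r (_ *: x)).
  by apply: h; rewrite add0r; apply: df; exact: balancedZ.
by apply: hM; exists x, l; split=> //; rewrite subrr rnorm0 ltW.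
Qed.

Lemma slice_coef_scale j x s : 0 < s <= 1 -> U x ->
  slice_coef f j (s%:C *: x) = s%:C ^+ j * slice_coef f j x.
Proof.
move=> s01 /orbit_disc_bnd[M hM]; rewrite -(coef_scale _ s01 hM) /slice_coef.
by congr coef; apply/funext => l; rewrite scalerA mulrC.
Qed.

Lemma slice_coef_rescale j x s t : 0 < s -> 0 < t -> U (s%:C *: x) -> U (t%:C *: x) ->
  s%:C^-1 ^+ j * slice_coef f j (s%:C *: x) = t%:C^-1 ^+ j * slice_coef f j (t%:C *: x).
Proof.
wlog st : s t / s <= t.
  move=> h s0 t0 Us Ut; have [st|/ltW ts] := leP s t; first exact: h.
  by symmetry; exact: h.
move=> s0 t0 Us Ut.
have tN : t%:C != 0 :> C by rewrite gt_eqF// ltcR.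
have sN : s%:C != 0 :> C by rewrite gt_eqF// ltcR.
have -> : s%:C *: x = (s / t)%:C *: (t%:C *: x).
  by rewrite scalerA -rmorphM /= divfK// gt_eqF.
rewrite slice_coef_scale//; last by rewrite divr_gt0//= ler_pdivrMr// mul1r.
rewrite mulrA -exprMn; congr (_ ^+ _ * _).
by rewrite fmorph_div mulKf.
Qed.

Context (r M : R) (r0 : 0 < r).
Context (fr : forall x, rnorm x <= r -> U x /\ rnorm (f x) <= M).

Let nx1 x : 0 < rnorm x + 1.
Proof. by rewrite ltr_wpDl// rnorm_ge0. Qed.

(** Any rescaling that brings [x] into [U] gives the same value; this frees the
    definition from its particular scaling factor, which depends on [x] through
    the norm and so spoils differentiability. *)
Lemma taylor_termE j x s : 0 < s -> U (s%:C *: x) ->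
  taylor_term f r j x = s%:C^-1 ^+ j * slice_coef f j (s%:C *: x).
Proof.
move=> s0 Us; apply: slice_coef_rescale => //; first by rewrite divr_gt0.
apply: (fr _).1; rewrite rnormZ rnorm_real ger0_norm ?divr_ge0 ?(ltW r0) ?(ltW (nx1 x))//.
by rewrite mulrAC ler_pdivrMr// ler_wpM2l ?(ltW r0)// lerDl.
Qed.

Lemma taylor_term_small j x s : 0 < s -> rnorm x <= r / s ->
  taylor_term f r j x = s%:C^-1 ^+ j * slice_coef f j (s%:C *: x).
Proof.
move=> s0 xs; apply: taylor_termE => //; apply: (fr _).1.
by rewrite rnormZ rnorm_real gtr0_norm// mulrC -ler_pdivlMr.
Qed.

Lemma taylor_term_bnd j x s : 0 < s -> rnorm x <= r / s ->
  rnorm (taylor_term f r j x) <= s^-1 ^+ j * M.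
Proof.
move=> s0 xs; rewrite (taylor_term_small _ s0)// rnormM rnormX rnormV rnorm_real gtr0_norm//.
rewrite ler_wpM2l ?exprn_ge0 ?invr_ge0 ?(ltW s0)//; apply: lim_mean_le => l l1.
rewrite rnormM rnormX rnormV l1 invr1 expr1n mulr1; apply: (fr _).2.
by rewrite !rnormZ l1 mul1r rnorm_real gtr0_norm// mulrC -ler_pdivlMr.
Qed.

Lemma mean_differentiable n (G : X -> C -> C) x :
  (forall l, rnorm l = 1 -> differentiable (G^~ l) x) ->
  differentiable (fun y => mean n (G y)) x.
Proof.
move=> dG; rewrite /mean /left_sum.
apply: (@differentiableZ R[i] X C); apply: (@differentiableZ R[i] X C).
have := @differentiable_sum R[i] X C (2 ^ n)
  (fun (k : 'I_(2 ^ n)) y => G y (cexp 0 (0 + 2 * pi * k%:R / 2 ^+ n))) x.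
rewrite fct_sumE; apply => k; apply: dG.
by rewrite rnorm_cexp expR0.
Qed.

(** Near a point the scaling factor can be kept fixed, and then the term is a bounded
    limit of averages of holomorphic functions. *)
Lemma taylor_term_Hb j : Hb setT (taylor_term f r j).
Proof.
have [df _] := (HbP U f).1 Uf.
apply/HbP; split=> [x _|A [/bounded_rnormP[K AK] _ _]]; last first.
  pose s := r / (`|K| + 1); have K1 : 0 < `|K| + 1 by rewrite ltr_wpDl.
  have s0 : 0 < s by rewrite divr_gt0.
  exists (s^-1 ^+ j * M) => x Ax; apply: taylor_term_bnd => //.
  rewrite /s invf_div mulrCA divff ?gt_eqF// mulr1.
  by rewrite (le_trans (AK _ Ax))// (le_trans (ler_norm K))// lerDl.
pose s := r / (rnorm x + 2).
have x2 : 0 < rnorm x + 2 by rewrite ltr_wpDl// rnorm_ge0.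
have s0 : 0 < s by rewrite divr_gt0.
have near y : rnorm (y - x) <= 1 -> rnorm y <= r / s.
  move=> yx; rewrite /s invf_div mulrCA divff ?gt_eqF// mulr1.
  rewrite -[y](subrK x) (le_trans (rnormD _ _))// addrC lerD2l (le_trans yx)//.
  by rewrite ler1n.
have near' y (l : C) : rnorm l = 1 -> rnorm (y - x) <= 1 -> rnorm (l *: (s%:C *: y)) <= r.
  move=> l1 /near yr; rewrite !rnormZ l1 mul1r rnorm_real gtr0_norm// mulrC.
  by rewrite -ler_pdivlMr.
pose G y (l : C) : C := f (l *: (s%:C *: y)) * l^-1 ^+ j.
have GM y : rnorm (y - x) <= 1 -> forall l, rnorm l = 1 -> rnorm (G y l) <= M.
  move=> yx l l1; rewrite rnormM rnormX rnormV l1 invr1 expr1n mulr1.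
  by apply: (fr _).2; exact: near'.
apply: (@ball_bnd_limit R X (fun n y => s%:C^-1 ^+ j * mean n (G y)) _ _ 1 (s^-1 ^+ j * M)) => //.
  move=> n y yx; split.
    apply: (@differentiableZ R[i] X C); apply: mean_differentiable => l l1.
    have h : differentiable (f \o (fun y : X => (l * s%:C) *: y)) y.
      apply: differentiable_comp; first exact: (@differentiableZ R[i] X X (fun x : X => x)).
      by apply: df; rewrite -scalerA; apply: (fr _).1; exact: near'.
    rewrite /G; under eq_fun do rewrite scalerA.
    exact: (differentiableM h (differentiable_cst _ _)).
  rewrite rnormM rnormX rnormV rnorm_real gtr0_norm// ler_wpM2l ?exprn_ge0 ?invr_ge0 ?(ltW s0)//.
  by apply: mean_le; exact: GM.
move=> y yx; rewrite (taylor_term_small _ s0 (near _ yx)).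
by apply: cvgM; [exact: cvg_cst|apply: lim_mean_cvg; exists M; exact: GM].
Qed.

End density.

(** The approximant is the Fejer mean of the Taylor series.  On the circle
    [l *: x] the function [f] is Lipschitz at [x] with a constant that is the same
    for all [x] in [A]: for [l] near [1] by [ball_lipschitz] on a ball of fixed
    radius, and otherwise because [f] is bounded on the hull of [A]. *)
Lemma entire_dense (R : realType) (X : normedModType R[i]) (U : set X)
    (f : X -> Cplx R) (A : set X) (e : R) :
  U !=set0 -> balanced U -> open U -> Hb U f -> Ubounded U A -> 0 < e ->
  exists2 P, Hb setT P & forall x, A x -> rnorm (P x - f x) <= e.
Proof.
move=> U0 bU oU Uf AU e0; have [df bf] := (HbP U f).1 Uf.
have [K [_ [K0 _ AK _]]] := Ubounded_ball oU AU.
have [d d0 hull] := Ubounded_hull U0 bU oU AU.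
have [M hM] := bf _ hull.
have [r [M0 [r0 fr]]] : exists r M0 : R, 0 < r /\
    (forall x, rnorm x <= r -> U x /\ rnorm (f x) <= M0).
  have := Ubounded_hull U0 bU oU (A := [set 0]).
  case=> [|r r0 hr].
    have [d' d'0 hd'] : exists2 d : R, 0 < d & forall y : X, rnorm (y - 0) <= d -> U y.
      by apply/nbhs_rnorm; apply: open_nbhs_nbhs; split=> //; exact: balanced0.
    apply: (@ball_Ubounded _ _ _ _ 0 d') => //; first by move=> _ ->; rewrite rnorm0.
    by move=> _ y -> /ltW; exact: hd'.
  have [M0 hM0] := bf _ hr; exists r, M0; split=> // x xr.
  have hx : [set y | exists (x0 : X) (a : Cplx R),
      [/\ [set 0] x0, rnorm a <= 1 & rnorm (y - a *: x0) <= r]] x.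
    by exists 0, 0; rewrite scaler0 subr0 rnorm0.
  by split; [case: hr => _ + _; apply|exact: hM0].
pose L := 4 * `|M| * K / d.
have L0 : 0 <= L by rewrite !mulr_ge0 ?invr_ge0 ?(ltW d0).
have [J [eta [J0 eta0]]] := fejer_rate (lexx 0) L0 e0.
rewrite mul0r add0r => hJ.
exists (fun x => fejer_sum (fun i => taylor_term f r i x) J).
  apply: (HbZ _ (f := fun x => \sum_(b < J) \sum_(i < b.+1) taylor_term f r i x)).
  by apply: Hb_sum => b; apply: Hb_sum => i; exact: taylor_term_Hb fr _.
move=> x Ax; have Ux : U x by case: AU => _ + _; apply.
have [N hN] := orbit_disc_bnd U0 bU oU Uf Ux.
have -> : (fun i => taylor_term f r i x) = coef^~ (fun l : Cplx R => f (l *: x)).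
  apply/funext => i; rewrite (taylor_termE U0 bU oU Uf r0 fr i (s := 1))// ?scale1r//.
  by rewrite invr1 expr1n mul1r.
rewrite -[in f x](scale1r x) (le_trans _ hJ)//.
apply: (fejer_approx J0 hN L0 eta0) => l l1.
have xM : ball_bnd f x d `|M|.
  move=> y yx; have yh : [set y | exists (x0 : X) (a : Cplx R),
      [/\ A x0, rnorm a <= 1 & rnorm (y - a *: x0) <= d]] y.
    by exists x, 1; rewrite scale1r rnorm1.
  split; first by apply: df; case: hull => _ + _; apply.
  by rewrite (le_trans (hM _ yh))// ler_norm.
rewrite scale1r.
have lx : l *: x = x + (l - 1) *: x by rewrite scalerBl scale1r subrKC.
have l10 := rnorm_ge0 (l - 1).
have lK : rnorm ((l - 1) *: x) <= rnorm (l - 1) * K by rewrite rnormZ ler_wpM2l ?AK.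
have [small|big] := leP (rnorm ((l - 1) *: x)) (d / 2).
  rewrite lx (le_trans (ball_lipschitz d0 xM small))//.
  rewrite (@le_trans _ _ (2 * `|M| / d * (rnorm (l - 1) * K)))//.
    by rewrite ler_wpM2l// !mulr_ge0 ?invr_ge0 ?(ltW d0).
  rewrite (_ : L * _ = 2 * (2 * `|M| / d * (rnorm (l - 1) * K))); last by rewrite /L; ring.
  by rewrite ler_peMl ?ler1n// !mulr_ge0 ?invr_ge0 ?(ltW d0).
have hlx (a : Cplx R) : rnorm a = 1 -> rnorm (f (a *: x)) <= `|M|.
  move=> a1; rewrite (le_trans (hM _ _))// ?ler_norm//.
  by exists x, a; rewrite a1 subrr rnorm0 (ltW d0).
rewrite (le_trans (rnormD _ _))// rnormN.
have h1 := hlx _ l1; have h2 := hlx 1 (rnorm1 (R := R)); rewrite scale1r in h2.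
rewrite (le_trans (lerD h1 h2))//.
rewrite (_ : L * _ = 2 * `|M| * (2 * (rnorm (l - 1) * K) / d)); last by rewrite /L; ring.
rewrite (_ : `|M| + `|M| = 2 * `|M|); last by ring.
rewrite ler_peMr ?mulr_ge0// ler_pdivlMr// mul1r.
by have := lt_le_trans big lK; lra.
Qed.

(** * Cluster sets and characters *)

Section cluster.
Context {R : realType} {X : normedModType R[i]}.
Local Notation C := (Cplx R).
Implicit Types (U A : set X) (f g : X -> C) (z : bidual X) (c : C) (e : R).
Implicit Types (phi : (X -> C) -> C).

Lemma tails_filter I (le : I -> I -> Prop) : directed le -> ProperFilter (tails le).
Proof.
move=> [[i0] refl trans dir]; apply: Build_ProperFilter_ex.
  by move=> S [i hi]; exists i; exact: hi.
split.
- by exists i0.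
- move=> P Q [i hi] [j hj]; have [k [ik jk]] := dir i j.
  by exists k => m km; split; [apply: hi|apply: hj]; apply: trans km.
- by move=> P Q PQ [i hi]; exists i => j ij; exact/PQ/hi.
Qed.

(** A weak-star neighborhood is tested on the finitely many functionals in [s], so
    that cluster sets can be handled without nets. *)
Definition cluster_pt A f z c (s : seq (dual X)) e x :=
  [/\ A x, forall l : dual X, l \in s -> rnorm (l x - z l) <= e & rnorm (f x - c) <= e].

(** The pairs of a list of functionals and an accuracy form a directed set, along
    which the chosen points give a net. *)
Lemma cluster_setP A f z c : cluster_set A f z c <->
  forall (s : seq (dual X)) e, 0 < e -> exists x, cluster_pt A f z c s e x.
Proof.
split=> [[I [le [x [dle Ax xz fc]]]] s e e0|h].
- have FF := tails_filter dle.
  have xl (l : dual X) : (fun i => l (x i)) @ tails le --> (z l : C).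
    have := @proj_continuous _ (fun=> C) l (z : dual X -> C).
    by move=> /(cvg_comp _ _ xz).
  have near_s : tails le [set i | forall l : dual X, l \in s -> rnorm (l (x i) - z l) <= e].
    elim: s => [|l s IH]; first by apply: filterS filterT => i _ l.
    have /cvg_rnorm /(_ _ e0) hl := xl l.
    apply: filterS2 hl IH => i /= h1 h2 m; rewrite inE => /predU1P[->//|]; exact: h2.
  have /cvg_rnorm /(_ _ e0) hf := fc.
  have [i [h1 h2]] := filter_ex (filterI near_s hf).
  by exists (x i).
- pose I := (seq (dual X) * nat)%type.
  pose le (i j : I) := {subset i.1 <= j.1} /\ (i.2 <= j.2)%N.
  have hI (i : I) : exists x, cluster_pt A f z c i.1 (i.2.+1%:R^-1) x.
    by apply: h; rewrite invr_gt0 ltr0n.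
  pose x i := sval (cid (hI i)).
  have hx i : cluster_pt A f z c i.1 (i.2.+1%:R^-1) (x i) by rewrite /x; case: cid.
  have dle : directed le.
    split; first by constructor; exact: ([::], 0%N).
    - by move=> i; split.
    - by move=> i j k [h1 h2] [h3 h4]; split; [move=> l /h1/h3|exact: leq_trans h4].
    - move=> i j; exists (i.1 ++ j.1, maxn i.2 j.2); split; split => /=.
      + by move=> l li; rewrite mem_cat li.
      + exact: leq_maxl.
      + by move=> l li; rewrite mem_cat li orbT.
      + exact: leq_maxr.
  have FF := tails_filter dle.
  have small e : 0 < e -> exists N : nat, forall n, (N <= n)%N -> n.+1%:R^-1 <= e.
    move=> e0; exists (Num.bound e^-1) => n Nn.
    rewrite -[e]invrK lef_pV2 ?posrE ?invr_gt0 ?ltr0n//.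
    have := archi_boundP (_ : 0 <= e^-1); rewrite invr_ge0 (ltW e0) => /(_ isT)/ltW/le_trans; apply.
    by rewrite ler_nat (leq_trans Nn).
  exists I, le, x; split=> //; first by move=> i; have [] := hx i.
    apply/pointwise_cvgP => l; apply/cvg_rnorm => e e0; have [N hN] := small _ e0.
    exists ([:: l], N) => i [/= li Ni]; have [_ h2 _] := hx i.
    by rewrite (le_trans (h2 l _)) ?hN// li ?mem_head.
  apply/cvg_rnorm => e e0; have [N hN] := small _ e0.
  exists ([::], N) => i [_ /= Ni]; have [_ _ h3] := hx i.
  by rewrite /= (le_trans h3)// hN.
Qed.

Lemma prec_le U phi A f (M : R) : prec U phi A -> Hb U f ->
  (forall x, A x -> rnorm (f x) <= M) -> rnorm (phi f) <= M.
Proof.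
move=> pA Uf fM; rewrite -lee_fin (le_trans (pA f Uf))//.
by apply: ge_ereal_sup => _ [x Ax <-]; rewrite lee_fin fM.
Qed.

Lemma prec_neq0 U phi A : prec U phi A -> A !=set0.
Proof.
move=> pA; apply/set0P/eqP => A0.
by have := pA _ (Hb_cst U 0); rewrite A0 image_set0 ereal_sup0.
Qed.

(** On a [U]-bounded set the supremum is finite, so domination can be tested on real
    bounds. *)
Lemma le_prec U phi A : A !=set0 -> Ubounded U A ->
  (forall f (M : R), Hb U f -> (forall x, A x -> rnorm (f x) <= M) -> rnorm (phi f) <= M) ->
  prec U phi A.
Proof.
move=> [x0 Ax0] AU h f Uf.
have [M fM] := ((HbP U f).1 Uf).2 A AU.
set S := [set _ | x in A].
have S0 : (0%:E <= ereal_sup S)%E.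
  apply: (@le_trans _ _ (rnorm (f x0))%:E); first by rewrite lee_fin rnorm_ge0.
  by apply: ereal_sup_ubound; exists x0.
have SM : (ereal_sup S <= M%:E)%E.
  by apply: ge_ereal_sup => _ [x Ax <-]; rewrite lee_fin fM.
have Sfin : ereal_sup S \is a fin_num.
  by rewrite fin_numE -ltNye -ltey (lt_le_trans _ S0) ?ltNyr// (le_lt_trans SM) ?ltry.
rewrite -(fineK Sfin) lee_fin; apply: h => // x Ax.
by rewrite -lee_fin fineK//; apply: ereal_sup_ubound; exists x.
Qed.

Lemma dominated_continuous U phi A : Ubounded U A ->
  (forall f g e, Hb U f -> Hb U g -> 0 < e ->
     (forall x, A x -> rnorm (f x - g x) <= e) -> rnorm (phi f - phi g) <= e) ->
  {within (Hb U : set (Hb_space U)), continuous (phi : Hb_space U -> C)}.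
Proof.
move=> AU h; apply/subspace_continuousP => f Uf; apply/cvg_rnorm => e e0.
have ent : entourage [set p : C * C | rnorm (p.2 - p.1) <= e].
  have eC : 0 < e%:C by rewrite ltcR.
  apply: filterS (@entourage_ball R[i] C (PosNum eC)) => -[a b] /=.
  rewrite -ball_normE /= => ab; rewrite rnorm_distC rnorm_le; exact: ltW.
have := @fam_nbhs X C (Ubounded U) A _ f ent AU.
by apply: filterS => g /= hg Ug; apply: h.
Qed.

(** Domination by one [U]-bounded set already implies continuity. *)
Lemma character_prec U phi A :
  Ubounded U A ->
  (forall f g, Hb U f -> Hb U g -> (forall x, U x -> f x = g x) -> phi f = phi g) ->
  (forall f g, Hb U f -> Hb U g -> phi (f + g) = phi f + phi g) ->
  (forall (a : R[i]) f, Hb U f -> phi (a *: f) = a *: phi f) ->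
  (forall f g, Hb U f -> Hb U g -> phi (fun x => f x * g x) = phi f * phi g) ->
  phi (fun=> 1) != 0 -> prec U phi A -> character U phi.
Proof.
move=> AU heq hD hZ hM h1 pA; split=> //; first by exists (fun=> 1) => //; exact: Hb_cst.
apply: (dominated_continuous AU) => f g e Uf Ug e0 fg.
have -> : phi f - phi g = phi (f - g).
  have -> : f - g = f + (-1 : R[i]) *: g by rewrite scaleN1r.
  by rewrite (hD _ _ Uf (HbZ _ Ug)) (hZ _ _ Ug) scaleN1r.
exact: (prec_le pA (HbB Uf Ug)).
Qed.

End cluster.

(** * The cluster value theorem on balanced sets *)

Section fibers.
Context {R : realType} {X : normedModType R[i]}.
Local Notation C := (Cplx R).
Implicit Types (U A : set X) (f g : X -> C) (z : bidual X) (c : C) (e : R).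
Implicit Types (phi psi : (X -> C) -> C).

(** The sets [cluster_pt A f z c s e] generate a filter containing [A]; limits along
    an ultrafilter that refines it exist for all functions bounded on [A] and
    respect sums and products. *)
Lemma cluster_sub_fiber U A f z c : Ubounded U A -> Hb U f -> cluster_set A f z c ->
  exists2 phi, fiber U z A phi & phi f = c.
Proof.
move=> AU Uf /cluster_setP h.
pose F : set_system X := [set S | exists (s : seq (dual X)) (e : R), 0 < e /\
  forall x, cluster_pt A f z c s e x -> S x].
have FF : ProperFilter F.
  apply: Build_ProperFilter_ex.
    by move=> S [s [e [e0 hS]]]; have [x /hS] := h s e e0; exists x.
  split.
  - by exists [::], 1.
  - move=> S T [s [e [e0 hS]]] [t [d [d0 hT]]].
    exists (s ++ t), (Num.min e d); rewrite lt_min e0 d0; split=> // x [Ax xl xf].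
    move: xf; rewrite le_min => /andP[xe xd].
    split; [apply: hS|apply: hT]; split=> // l ls;
      by have := xl l; rewrite mem_cat ls ?orbT le_min => /(_ isT)/andP[].
  - by move=> S T ST [s [e [e0 hS]]]; exists s, e; split=> // x /hS/ST.
have [G [GU FG]] := ultraFilterLemma FF.
have GA : G A by apply: FG; exists [::], 1; split=> // x [].
have A0 : A !=set0 by have [x] := filter_ex GA; exists x.
pose phi g : C := lim (g @ G).
have bG g M : (forall x, A x -> rnorm (g x) <= M) -> G [set x | rnorm (g x) <= M].
  by move=> gM; apply: filterS GA => x /gM.
have cvg_phi g : Hb U g -> g @ G --> phi g.
  move=> /HbP[_ /(_ A AU)[M gM]].
  have [d hd] := ultra_cvg GU (bG _ _ gM).
  exact: cvgP hd.
have phiE g d : Hb U g -> g @ G --> d -> phi g = d.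
  by move=> /cvg_phi h1 h2; exact: cvg_unique_rnorm h1 h2.
have phif : phi f = c.
  apply: phiE => //; apply/cvg_rnorm => e e0; apply: FG.
  by exists [::], e; split=> // x [].
exists phi => //; split.
- apply: (@character_prec _ _ U phi A) => //.
  + move=> f1 f2 U1 U2 f12; apply: (phiE _ _ U1); apply/cvg_rnorm => e e0.
    have /cvg_rnorm /(_ _ e0) := cvg_phi _ U2.
    by apply: filterS2 GA => x Ax /=; rewrite f12//; case: AU => _ + _; apply.
  + move=> f1 f2 U1 U2; apply: phiE; first exact: HbD.
    exact: cvgD (cvg_phi _ U1) (cvg_phi _ U2).
  + move=> a f1 U1; apply: phiE; first exact: HbZ.
    by apply: cvgZl_tmp; exact: cvg_phi.
  + move=> f1 f2 U1 U2; apply: phiE; first exact: HbM.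
    exact: cvgM (cvg_phi _ U1) (cvg_phi _ U2).
  + rewrite (phiE _ 1); [exact: oner_neq0|exact: Hb_cst|exact: cvg_cst].
  + apply: le_prec => // f1 M U1 /bG; exact: cvg_rnorm_le (cvg_phi _ U1).
- apply/funext => l; apply: phiE; first exact: Hb_dual.
  apply/cvg_rnorm => e e0; apply: FG; exists [:: l], e; split=> // x [_ + _].
  by apply; rewrite mem_head.
- apply: le_prec => // f1 M U1 /bG; exact: cvg_rnorm_le (cvg_phi _ U1).
Qed.

Lemma cluster_value_theoremP U : cluster_value_theorem U <->
  forall f z A phi, Hb U f -> Ubounded U A -> fiber U z A phi -> cluster_set A f z (phi f).
Proof.
split=> [h f z A phi Uf AU zphi|h f Uf z A AU].
  by rewrite (h f Uf z A AU); exists phi.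
apply/seteqP; split=> [c /(cluster_sub_fiber AU Uf)[phi zphi <-]|_ [phi zphi <-]].
  by exists phi.
exact: h.
Qed.

Lemma character1 U phi : character U phi -> phi (fun=> 1) = 1.
Proof.
case=> _ _ _ hM [f Uf f0] _.
have := hM _ _ (Hb_cst U 1) Uf.
under [in LHS]eq_fun do rewrite mul1r.
by move=> /esym; rewrite -[RHS]mul1r => /(mulIf f0).
Qed.

Lemma characterB U phi f g : character U phi -> Hb U f -> Hb U g ->
  phi (f - g) = phi f - phi g.
Proof.
case=> _ hD hZ _ _ _ Uf Ug.
have -> : f - g = f + (-1 : R[i]) *: g by rewrite scaleN1r.
by rewrite (hD _ _ Uf (HbZ _ Ug)) (hZ _ _ Ug) scaleN1r.
Qed.

Lemma fiber_restrict U A z phi : Ubounded U A -> fiber U z A phi -> fiber setT z A phi.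
Proof.
move=> AU [phiU phiz phiA].
have pA : prec setT phi A.
  by move=> f /(Hb_subT U) Uf; exact: phiA.
split=> //; have [heq hD hZ hM h0 hc] := phiU.
apply: (@character_prec _ _ setT phi A) => //.
- exact: Ubounded_subT AU.
- by move=> f g _ _ fg; congr phi; apply/funext => x; exact: fg.
- by move=> f g /(Hb_subT U) + /(Hb_subT U); exact: hD.
- by move=> a f /(Hb_subT U); exact: hZ.
- by move=> f g /(Hb_subT U) + /(Hb_subT U); exact: hM.
- by rewrite (character1 phiU) oner_neq0.
Qed.

(** An entire approximant [P] of [f] on [A] has nearly the same value as [f] under
    [phi], by domination, and at the point of [A] found for [P]. *)
Lemma cluster_value_balanced U : U !=set0 -> balanced U -> open U ->
  cluster_value_theorem [set: X] -> cluster_value_theorem U.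
Proof.
move=> U0 bU oU /cluster_value_theoremP cvt; apply/cluster_value_theoremP => f z A phi Uf AU zphi.
have TA := Ubounded_subT AU; have zphi' := fiber_restrict AU zphi.
have [phiU phiz phiA] := zphi.
apply/cluster_setP => s e e0; have e3 : 0 < e / 3 by rewrite divr_gt0.
have [P TP Pf] := entire_dense U0 bU oU Uf AU e3.
have /cluster_setP/(_ s _ e3)[x [Ax xl xP]] := cvt _ _ _ _ TP TA zphi'.
have ee : e / 3 <= e by rewrite ler_pdivrMr// ler_peMr ?ler1n// ltW.
exists x; split=> // [l /xl/le_trans|]; first exact.
have phiPf : rnorm (phi P - phi f) <= e / 3.
  rewrite -(characterB phiU (Hb_subT U TP) Uf).
  exact: (prec_le phiA (HbB (Hb_subT U TP) Uf) Pf).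
rewrite (le_trans (rnorm_triangle (P x) _ _))//.
have h := le_trans (rnorm_triangle (phi P) (P x) (phi f)) (lerD xP phiPf).
have := Pf x Ax; rewrite rnorm_distC => h'.
by rewrite (le_trans (lerD h' h))// le_eqVlt; apply/orP; left; apply/eqP; field.
Qed.

(** With [t] a small dilation factor and [B] the image of [A], the character over
    [U] sends [g] to the limit of [psi (x |-> P (t *: x))] over entire functions
    [P] that approximate [g] on [B].  Its value at the entire function
    [y |-> f (t^-1 *: y)] is [psi f]. *)
Lemma cluster_value_whole U : U !=set0 -> balanced U -> open U ->
  cluster_value_theorem U -> cluster_value_theorem [set: X].
Proof.
move=> U0 bU oU /cluster_value_theoremP cvt; apply/cluster_value_theoremP => f z A psi Tf TA.
move=> [psiT psiz psiA].
have [/bounded_rnormP[K AK] _ _] := TA.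
have [r r0 hr] : exists2 r : R, 0 < r & forall y : X, rnorm (y - 0) <= r -> U y.
  by apply/nbhs_rnorm; apply: open_nbhs_nbhs; split=> //; exact: balanced0.
pose t := r / 2 / (`|K| + 1).
have K1 : 0 < `|K| + 1 by rewrite ltr_wpDl.
have t0 : 0 < t by rewrite !divr_gt0.
pose tC : C := t%:C.
have tN : tC != 0 by rewrite gt_eqF// ltcR.
pose B := [set tC *: x | x in A].
have Br y : B y -> rnorm y <= r / 2.
  move=> [x Ax <-]; rewrite rnormZ rnorm_real gtr0_norm// /t mulrAC ler_pdivrMr//.
  rewrite ler_wpM2l ?divr_ge0 ?(ltW r0)// (le_trans (AK _ Ax))//.
  by rewrite (le_trans (ler_norm K))// lerDl.
have BU : Ubounded U B.
  apply: (@ball_Ubounded _ _ _ _ (r / 2) (r / 2)) => //; first by rewrite divr_gt0.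
  move=> x y /Br xr yx; apply: hr; rewrite subr0 -[y](subrK x) (splitr r).
  by rewrite (le_trans (rnormD _ _))// lerD// ltW.
have A0 : A !=set0 := prec_neq0 psiA.
have B0 : B !=set0 by have [x Ax] := A0; exists (tC *: x), x.
have psiB P Q e : Hb setT P -> Hb setT Q -> (forall y, B y -> rnorm (P y - Q y) <= e) ->
    rnorm (psi (fun x => P (tC *: x)) - psi (fun x => Q (tC *: x))) <= e.
  move=> TP TQ PQ; have TP' := Hb_compZ tC TP; have TQ' := Hb_compZ tC TQ.
  rewrite -(characterB psiT TP' TQ').
  by apply: (prec_le psiA (HbB TP' TQ')) => x Ax; apply: PQ; exists x.
(* All approximants are tested at once, so that the limit is determined by [g] on [B]. *)
pose lim_of g c := forall P e, Hb setT P -> (forall y, B y -> rnorm (P y - g y) <= e) ->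
  rnorm (psi (fun x => P (tC *: x)) - c) <= e.
have lim_ex g : Hb U g -> exists c, lim_of g c.
  move=> Ug.
  have hP n : exists P, Hb setT P /\ forall y, B y -> rnorm (P y - g y) <= n.+1%:R^-1.
    have n0 : 0 < n.+1%:R^-1 :> R by rewrite invr_gt0 ltr0n.
    by have [P TP hP] := entire_dense U0 bU oU Ug BU n0; exists P.
  pose P n := sval (cid (hP n)).
  have TP n : Hb setT (P n) by rewrite /P; case: cid => ? [].
  have Pg n y : B y -> rnorm (P n y - g y) <= n.+1%:R^-1.
    by rewrite /P; case: cid => Q [TQ Qg] /=; exact: Qg.
  pose u n : C := psi (fun x => P n (tC *: x)).
  have hu Q e n : Hb setT Q -> (forall y, B y -> rnorm (Q y - g y) <= e) ->
      rnorm (psi (fun x => Q (tC *: x)) - u n) <= e + n.+1%:R^-1.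
    move=> TQ Qg; apply: (psiB _ _ _ TQ (TP n)) => y By.
    by rewrite (le_trans (rnorm_triangle (g y) _ _))// lerD ?Qg// rnorm_distC Pg.
  have [c uc] : exists c : C, u @ nat_ultra --> c.
    apply: (@ultra_cvg _ _ _ _ _ (rnorm (u 0%N) + 2)).
    apply: (@nat_ultra_eventually _ 0%N) => n _ /=.
    rewrite -[u n](subrK (u 0%N)) (le_trans (rnormD _ _))// addrC lerD2l.
    rewrite rnorm_distC (le_trans (hu _ _ n (TP 0%N) (Pg 0%N)))//.
    rewrite (_ : 2 = 1 + 1 :> R)// lerD ?invr1//.
    by rewrite invf_le1 ?ler1n ?ltr0n.
  exists c => Q e TQ Qg; apply/ler_addgt0Pl => d d0.
  have d2 : 0 < d / 2 by rewrite divr_gt0.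
  have /cvg_rnorm /(_ _ d2) uc2 := uc.
  have : nat_ultra [set n | n.+1%:R^-1 <= d / 2].
    apply: (@nat_ultra_eventually _ (Num.bound (d / 2)^-1)) => n dn /=.
    rewrite -[d / 2]invrK lef_pV2 ?posrE ?invr_gt0 ?ltr0n//.
    have := archi_boundP (_ : 0 <= (d / 2)^-1); rewrite invr_ge0 (ltW d2).
    by move=> /(_ isT)/ltW/le_trans; apply; rewrite ler_nat (leq_trans dn).
  move=> /(filterI uc2)/filter_ex[n [/= un nd]].
  rewrite (le_trans (rnorm_triangle (u n) _ _))//.
  rewrite (le_trans (lerD (hu _ _ n TQ Qg) un))// [leRHS]addrC -addrA lerD2l.
  by rewrite [leRHS]splitr lerD2r.
pose phi g : C := xget 0 [set c | lim_of g c].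
have phiP g : Hb U g -> lim_of g (phi g) by move=> /lim_ex; exact: xgetPex.
have approx g e : Hb U g -> 0 < e -> exists2 P, Hb setT P &
    (forall y, B y -> rnorm (P y - g y) <= e) /\
    rnorm (psi (fun x => P (tC *: x)) - phi g) <= e.
  move=> Ug e0; have [P TP Pg] := entire_dense U0 bU oU Ug BU e0.
  by exists P => //; split=> //; exact: phiP.
have phi_unique g c : Hb U g -> (forall e, 0 < e -> exists2 P, Hb setT P &
    (forall y, B y -> rnorm (P y - g y) <= e) /\
    rnorm (psi (fun x => P (tC *: x)) - c) <= e) -> phi g = c.
  move=> Ug h; apply/eqP; rewrite -subr_eq0; apply/eqP/rnorm_le_eps => e e0.
  have e2 : 0 < e / 2 by rewrite divr_gt0.
  have [P TP [Pg Pc]] := h _ e2.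
  rewrite (le_trans (rnorm_triangle (psi (fun x => P (tC *: x))) _ _))// (splitr e) lerD//.
  by rewrite rnorm_distC; exact: phiP.
have phiT P : Hb setT P -> phi P = psi (fun x => P (tC *: x)).
  move=> TP; apply: (phi_unique _ _ (Hb_subT U TP)) => e e0; exists P => //.
  by split=> [y _|]; rewrite subrr rnorm0 ltW.
have Bbnd g : Hb U g -> exists2 M : R, 0 <= M & forall y, B y -> rnorm (g y) <= M.
  move=> /HbP[_ /(_ B BU)[M gM]]; exists `|M| => // y /gM/le_trans; apply.
  exact: ler_norm.
have [_ psiD psiZ psiM _ _] := psiT.
have phi_prec : prec U phi B.
  apply: le_prec => // g M Ug gM; apply/ler_addgt0Pl => e e0.
  have e2 : 0 < e / 2 by rewrite divr_gt0.
  have [P TP [Pg Pc]] := approx _ _ Ug e2.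
  have PM : rnorm (psi (fun x => P (tC *: x))) <= e / 2 + M.
    apply: (prec_le psiA (Hb_compZ tC TP)) => x Ax.
    have Bx : B (tC *: x) by exists x.
    by rewrite -[P _](subrK (g (tC *: x))) (le_trans (rnormD _ _))// lerD ?Pg ?gM.
  rewrite -[phi g](subrK (psi (fun x => P (tC *: x)))) (le_trans (rnormD _ _))//.
  by rewrite rnorm_distC (splitr e) -addrA lerD.
have phiU : character U phi.
  apply: (@character_prec _ _ U phi B) => //.
  - move=> g h Ug Uh gh; apply: (phi_unique _ _ Ug) => e e0.
    have [P TP [Ph Pc]] := approx _ _ Uh e0; exists P => //; split=> // y By.
    by rewrite gh ?Ph//; case: BU => _ + _; apply.
  - move=> g h Ug Uh; apply: (phi_unique _ _ (HbD Ug Uh)) => e e0.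
    have e2 : 0 < e / 2 by rewrite divr_gt0.
    have [P TP [Pg Pc]] := approx _ _ Ug e2; have [Q TQ [Qh Qc]] := approx _ _ Uh e2.
    exists (P + Q); first exact: HbD.
    split=> [y By|].
      rewrite !fctE opprD addrACA (le_trans (rnormD _ _))// (splitr e).
      by rewrite lerD ?Pg ?Qh.
    have := psiD _ _ (Hb_compZ tC TP) (Hb_compZ tC TQ).
    rewrite -[_ + _]/(fun x => (P + Q) (tC *: x)) => ->.
    by rewrite opprD addrACA (le_trans (rnormD _ _))// (splitr e) lerD.
  - move=> a g Ug; apply: (phi_unique _ _ (HbZ a Ug)) => e e0.
    have a1 : 0 < rnorm (a : C) + 1 by rewrite ltr_wpDl// rnorm_ge0.
    have ea : 0 < e / (rnorm (a : C) + 1) by rewrite divr_gt0.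
    have [P TP [Pg Pc]] := approx _ _ Ug ea.
    have ale d : d <= e / (rnorm (a : C) + 1) -> rnorm (a : C) * d <= e.
      move=> de; rewrite (le_trans (ler_wpM2l (rnorm_ge0 (a : C)) de))//.
      by rewrite mulrA ler_pdivrMr// mulrC ler_wpM2l ?(ltW e0)// lerDl.
    exists (a *: P); first exact: HbZ.
    split=> [y By|].
      by rewrite !fctE -scalerBr rnormZ ale ?Pg.
    have := psiZ a _ (Hb_compZ tC TP).
    rewrite -[_ *: _]/(fun x => (a *: P) (tC *: x)) => ->.
    by rewrite -scalerBr rnormZ ale.
  - move=> g h Ug Uh; apply: (phi_unique _ _ (HbM Ug Uh)) => e e0.
    have [M M0 gM] := Bbnd _ Ug; have [N N0 hN] := Bbnd _ Uh.
    pose k := M + N + rnorm (phi g) + rnorm (phi h) + 1.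
    have g0 := rnorm_ge0 (phi g); have h0 := rnorm_ge0 (phi h).
    have k0 : 0 < k by rewrite /k; lra.
    pose d := Num.min 1 (e / k).
    have d0 : 0 < d by rewrite lt_min ltr01 divr_gt0.
    have d1 : d <= 1 by rewrite ge_min lexx.
    have dk : d * k <= e by rewrite -ler_pdivlMr// ge_min lexx orbT.
    have [P TP [Pg Pc]] := approx _ _ Ug d0; have [Q TQ [Qh Qc]] := approx _ _ Uh d0.
    have prod (a b a' b' : C) : rnorm (a - a') <= d -> rnorm (b - b') <= d ->
        rnorm a' + rnorm b' + 1 <= k -> rnorm (a * b - a' * b') <= e.
      move=> aa bb abk.
      have -> : a * b - a' * b' = (a - a') * (b - b') + (a - a') * b' + a' * (b - b') by ring.
      apply: le_trans dk; rewrite (le_trans (rnormD _ _))//.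
      rewrite (le_trans (lerD (rnormD _ _) (lexx _)))// !rnormM.
      have a0' := rnorm_ge0 a'; have b0' := rnorm_ge0 b'.
      have x1 : rnorm (a - a') * rnorm (b - b') <= d * 1.
        by rewrite ler_pM ?rnorm_ge0// (le_trans bb).
      have x2 : rnorm (a - a') * rnorm b' <= d * rnorm b' by rewrite ler_wpM2r.
      have x3 : rnorm a' * rnorm (b - b') <= d * rnorm a' by rewrite mulrC ler_wpM2r.
      rewrite (le_trans (lerD (lerD x1 x2) x3))// -!mulrDr ler_wpM2l ?(ltW d0)//.
      by lra.
    exists (fun y => P y * Q y); first exact: HbM.
    split=> [y By|].
      apply: prod; [exact: Pg|exact: Qh|].
      by have := gM _ By; have := hN _ By; rewrite /k; lra.
    rewrite (psiM _ _ (Hb_compZ tC TP) (Hb_compZ tC TQ)).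
    by apply: prod => //; rewrite /k; lra.
  - by rewrite (phiT _ (Hb_cst _ _)) (character1 psiT) oner_neq0.
have phiz : fiber U (tC *: z) B phi.
  split=> //; apply/funext => l.
  rewrite /spectrum_proj (phiT _ (Hb_dual setT l)).
  have -> : (fun x => l (tC *: x)) = tC *: (l : X -> C).
    by apply/funext => x; rewrite linearZ.
  rewrite (psiZ _ _ (Hb_dual setT l)).
  by have := congr1 (fun F => tC *: F l) psiz.
pose g := fun y => f (tC^-1 *: y).
have Tg : Hb setT g by exact: Hb_compZ.
have phig : phi g = psi f.
  rewrite (phiT _ Tg); congr psi; apply/funext => x.
  by rewrite /g scalerA mulVf// scale1r.
have := cvt _ _ _ _ (Hb_subT U Tg) BU phiz; rewrite phig => /cluster_setP h.
apply/cluster_setP => s e e0.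
pose d := Num.min e (t * e).
have d0 : 0 < d by rewrite lt_min e0 mulr_gt0.
have de : d <= e by rewrite ge_min lexx.
have dt : d <= t * e by rewrite ge_min lexx orbT.
have [_ [[x Ax <-] xl xf]] := h s d d0.
exists x; split=> //.
  move=> l /xl; rewrite linearZ => h1.
  have {h1} : rnorm (tC *: (l x - z l)) <= d by rewrite scalerBr; exact: h1.
  rewrite rnormZ rnorm_real gtr0_norm// => h1.
  by rewrite -(ler_pM2l t0) (le_trans h1).
by move: xf; rewrite /g scalerA mulVf// scale1r => /le_trans; apply.
Qed.

End fibers.

Theorem theorem2p6 (R : realType) (X : completeNormedModType R[i]) :
  [<-> cluster_value_theorem [set: X];
       forall U : set X, U !=set0 -> balanced U -> open U ->
         cluster_value_theorem U;
       exists U : set X, [/\ U !=set0, balanced U, open U &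
         cluster_value_theorem U]].
Proof.
tfae.
- by move=> cvt U U0 bU oU; exact: cluster_value_balanced.
- move=> cvt; exists setT.
  have T0 : [set: X] !=set0 by exists 0.
  have bT : balanced [set: X] by [].
  by split=> //; [exact: openT|apply: cvt => //; exact: openT].
- by move=> [U [U0 bU oU cvt]]; exact: (cluster_value_whole U0 bU oU cvt).
Qed.
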